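(* Let $\Bbbk$ be a field of characteristic $0$, let $H$ be a finite-dimensional semisimple Hopf algebra over $\Bbbk$, let $B$ be a right $H$-comodule algebra such that $A:=B^{\mathrm{co}H}\subseteq B$ is an $H$-Galois extension, and let $R\subseteq A$ be a central subalgebra of $B$. Suppose that $A$ is a finitely generated free $R$-module and that $B$ is a finitely generated free right $A$-module of rank $m$. Then $$d(B,R;\operatorname{tr}_{B_R})=_{R^\times} d(A,R;\operatorname{tr}_{A_R})^m.$$
   Context: The coaction on $B$ is written $b\mapsto\sum b_0\otimes b_1\in B\otimes H$, and $B^{\mathrm{co}H}=\{b\in B:\sum b_0\otimes b_1=b\otimes1\}$. The extension $B^{\mathrm{co}H}\subseteq B$ is $H$-Galois if the map $B\otimes_{B^{\mathrm{co}H}}B\to B\otimes H$, $b'\otimes b\mapsto\sum b'b_0\otimes b_1$, is bijective. For an algebra $C$ that is free of finite rank over a central subalgebra $R$, with $R$-basis $z_1,\dots,z_N$, $\operatorname{tr}_{C_R}:C\to R$ is the Hattori-Stallings trace map ($\operatorname{tr}_{C_R}(c)$ is the trace of the $R$-linear map left multiplication by $c$ on $C$), and the discriminant is $d(C,R;\operatorname{tr}_{C_R})=\det([\operatorname{tr}_{C_R}(z_iz_j)]_{i,j=1}^N)$, well defined up to multiplication by a unit of $R$. $x=_{R^\times}y$ means $x=uy$ for some $u\in R^\times$. *)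

(* Defs.v *)
From HB Require Import structures.
From mathcomp Require Import all_boot all_order all_algebra all_field.
From mathcomp Require Import generic_quotient.
From mathcomp Require Import boolp classical_sets.

Set Implicit Arguments.
Unset Strict Implicit.
Unset Printing Implicit Defensive.

Import GRing.Theory.
Local Open Scope ring_scope.
Local Open Scope quotient_scope.

(** * Balanced tensor products *)

(* The right action [ra] of [S] on [M] and the left action [la] on [N] are bare
   functions, so that this covers the tensor product of two modules over a
   field as well as that of a right and a left module over a noncommutative
   ring. *)
Section BalancedTensor.
Variables (S : Type) (M N : zmodType) (ra : M -> S -> M) (la : S -> N -> N).

(* A list [:: (x1, y1); ...; (xr, yr)] stands for x1 ⊗ y1 + ... + xr ⊗ yr.  No
   formal inverses are needed, since - (x ⊗ y) = (- x) ⊗ y. *)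
Inductive tensor_rel : seq (M * N) -> seq (M * N) -> Prop :=
  | tensor_rel_refl s : tensor_rel s s
  | tensor_rel_sym s t : tensor_rel s t -> tensor_rel t s
  | tensor_rel_trans s t u : tensor_rel s t -> tensor_rel t u -> tensor_rel s u
  | tensor_rel_cat s s' t t' :
      tensor_rel s s' -> tensor_rel t t' -> tensor_rel (s ++ t) (s' ++ t')
  | tensor_rel_catC s t : tensor_rel (s ++ t) (t ++ s)
  | tensor_rel_zero y : tensor_rel [:: (0, y)] [::]
  | tensor_rel_addl x x' y :
      tensor_rel [:: (x + x', y)] [:: (x, y); (x', y)]
  | tensor_rel_addr x y y' :
      tensor_rel [:: (x, y + y')] [:: (x, y); (x, y')]
  | tensor_rel_bal x a y : tensor_rel [:: (ra x a, y)] [:: (x, la a y)].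

Definition tensor_relb (s t : seq (M * N)) : bool := `[< tensor_rel s t >].

Lemma tensor_relb_refl : reflexive tensor_relb.
Proof. by move=> s; apply/asboolP; apply: tensor_rel_refl. Qed.

Lemma tensor_relb_sym : symmetric tensor_relb.
Proof.
by move=> s t; apply/asboolP/asboolP => h; apply: tensor_rel_sym.
Qed.

Lemma tensor_relb_trans : transitive tensor_relb.
Proof.
move=> t s u /asboolP st /asboolP tu; apply/asboolP.
exact: tensor_rel_trans tu.
Qed.

Canonical tensor_equiv :=
  EquivRel tensor_relb tensor_relb_refl tensor_relb_sym tensor_relb_trans.

Definition tensor : Type := {eq_quot tensor_equiv}.
HB.instance Definition _ := Choice.on tensor.
HB.instance Definition _ := EqQuotient.on tensor.

Definition tensor_pi (s : seq (M * N)) : tensor := \pi_tensor s.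
Definition pure (x : M) (y : N) : tensor := tensor_pi [:: (x, y)].

Lemma tensor_piP s t : tensor_pi s = tensor_pi t <-> tensor_rel s t.
Proof.
rewrite /tensor_pi; split; first by move/(@eqmodP _ tensor_equiv)/asboolP.
by move=> h; apply/(@eqmodP _ tensor_equiv)/asboolP.
Qed.

Lemma tensor_piK (t : tensor) : tensor_pi (repr t) = t.
Proof. exact: reprK. Qed.

Let oppl (s : seq (M * N)) := [seq (- p.1, p.2) | p <- s].

Let oppl_rel s t : tensor_rel s t -> tensor_rel (oppl s) (oppl t).
Proof.
have rel_opp x y : tensor_rel [:: (x, y); (- x, y)] [::].
  apply: tensor_rel_trans (tensor_rel_zero y).
  by rewrite -(subrr x); apply: tensor_rel_sym; apply: tensor_rel_addl.
have uniq_opp a b c : tensor_rel (a ++ b) [::] -> tensor_rel (a ++ c) [::] ->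
    tensor_rel b c.
  move=> ab ac.
  apply: (@tensor_rel_trans _ ((a ++ c) ++ b)).
    rewrite -[X in tensor_rel X _]cat0s.
    by apply: tensor_rel_cat; [apply: tensor_rel_sym | apply: tensor_rel_refl].
  apply: (@tensor_rel_trans _ ((a ++ b) ++ c)).
    rewrite -!catA; apply: tensor_rel_cat; first exact: tensor_rel_refl.
    exact: tensor_rel_catC.
  rewrite -[X in tensor_rel _ X]cat0s.
  by apply: tensor_rel_cat; [ | apply: tensor_rel_refl].
elim=> {s t} /=.
- by move=> s; apply: tensor_rel_refl.
- by move=> s t _; apply: tensor_rel_sym.
- by move=> s t u _ h1 _; apply: tensor_rel_trans.
- by move=> s s' t t' _ h _ h'; rewrite /oppl !map_cat; apply: tensor_rel_cat.
- by move=> s t; rewrite /oppl !map_cat; apply: tensor_rel_catC.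
- by move=> y; rewrite oppr0; apply: tensor_rel_zero.
- by move=> x x' y; rewrite opprD; apply: tensor_rel_addl.
- by move=> x y y'; apply: tensor_rel_addr.
- move=> x a y; apply: (uniq_opp [:: (ra x a, y)]); first exact: rel_opp.
  apply: tensor_rel_trans (rel_opp x (la a y)).
  apply: (@tensor_rel_cat [:: _] [:: _] [:: _] [:: _]).
    exact: tensor_rel_bal.
  exact: tensor_rel_refl.
Qed.

Definition tensor_zero : tensor := tensor_pi [::].
Definition tensor_add (t u : tensor) : tensor := tensor_pi (repr t ++ repr u).
Definition tensor_opp (t : tensor) : tensor :=
  tensor_pi [seq (- p.1, p.2) | p <- repr t].

Let repr_rel s : tensor_rel (repr (tensor_pi s)) s.
Proof. by apply/tensor_piP; rewrite tensor_piK. Qed.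

Let tensor_addE s t :
  tensor_add (tensor_pi s) (tensor_pi t) = tensor_pi (s ++ t).
Proof. by apply/tensor_piP; apply: tensor_rel_cat; apply: repr_rel. Qed.

Fact tensor_addA : associative tensor_add.
Proof.
move=> t u v; rewrite -(tensor_piK t) -(tensor_piK u) -(tensor_piK v).
by rewrite !tensor_addE catA.
Qed.

Fact tensor_addC : commutative tensor_add.
Proof. by move=> t u; apply/tensor_piP; apply: tensor_rel_catC. Qed.

Fact tensor_add0 : left_id tensor_zero tensor_add.
Proof. by move=> t; rewrite -(tensor_piK t) tensor_addE. Qed.

Fact tensor_addN : left_inverse tensor_zero tensor_opp tensor_add.
Proof.
move=> t; rewrite /tensor_opp -{2}(tensor_piK t) tensor_addE.
apply/tensor_piP; elim: (repr t) => [|[x y] s IHs] /=.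
  exact: tensor_rel_refl.
apply: (@tensor_rel_trans _ ([:: (- x, y); (x, y)] ++
    ([seq (- p.1, p.2) | p <- s] ++ s))).
  apply: (@tensor_rel_cat [:: _] [:: _]); first exact: tensor_rel_refl.
  rewrite -[X in tensor_rel _ X]/(([:: (x, y)] ++ _) ++ s).
  rewrite -cat_rcons -cats1.
  apply: tensor_rel_cat; [exact: tensor_rel_catC | exact: tensor_rel_refl].
rewrite -[X in tensor_rel _ X]cat0s; apply: tensor_rel_cat => //.
apply: tensor_rel_trans (tensor_rel_zero y).
by rewrite -(addNr x); apply: tensor_rel_sym; apply: tensor_rel_addl.
Qed.

HB.instance Definition _ := GRing.isZmodule.Build tensor
  tensor_addA tensor_addC tensor_add0 tensor_addN.

Definition balanced (Z : zmodType) (f : M -> N -> Z) : Prop :=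
  [/\ forall x x' y, f (x + x') y = f x y + f x' y,
      forall x y y', f x (y + y') = f x y + f x y' &
      forall x a y, f (ra x a) y = f x (la a y)].

(* [lift f t] is the sum of the f(x, y) over a chosen expression of t as a sum
   of the x ⊗ y.  It is the additive map induced by f as soon as f is balanced
   (lemma [lift_pi]), and it is only meaningful then. *)
Definition lift (Z : zmodType) (f : M -> N -> Z) (t : tensor) : Z :=
  \sum_(p <- repr t) f p.1 p.2.

Section Lift.
Variables (Z : zmodType) (f : M -> N -> Z).
Hypothesis balf : balanced f.

Lemma lift_pi s : lift f (tensor_pi s) = \sum_(p <- s) f p.1 p.2.
Proof.
have [fDl fDr fbal] := balf.
have f0 y : f 0 y = 0 by apply: (addrI (f 0 y)); rewrite -fDl !addr0.
have := repr_rel s; rewrite /lift; move: (repr _) => t; elim=> {s t} //.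
- by move=> s t u _ -> _ ->.
- by move=> s s' t t' _ h _ h'; rewrite !big_cat /= h h'.
- by move=> s t; rewrite !big_cat /= addrC.
- by move=> y; rewrite big_seq1 big_nil f0.
- by move=> x x' y; rewrite !big_cons !big_nil /= fDl !addr0.
- by move=> x y y'; rewrite !big_cons !big_nil /= fDr !addr0.
- by move=> x a y; rewrite !big_seq1 fbal.
Qed.

Lemma lift_pure x y : lift f (pure x y) = f x y.
Proof. by rewrite /pure lift_pi big_seq1. Qed.

Lemma liftD t u : lift f (t + u) = lift f t + lift f u.
Proof.
rewrite -(tensor_piK t) -(tensor_piK u) [_ + _]tensor_addE.
by rewrite !lift_pi big_cat.
Qed.

End Lift.

Lemma pureDl x x' y : pure (x + x') y = pure x y + pure x' y.
Proof.
by rewrite [RHS]tensor_addE; apply/tensor_piP; apply: tensor_rel_addl.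
Qed.

Lemma pureDr x y y' : pure x (y + y') = pure x y + pure x y'.
Proof.
by rewrite [RHS]tensor_addE; apply/tensor_piP; apply: tensor_rel_addr.
Qed.

Lemma pure_bal x a y : pure (ra x a) y = pure x (la a y).
Proof. by apply/tensor_piP; apply: tensor_rel_bal. Qed.

Lemma balanced_pure : balanced pure.
Proof. by split; [apply: pureDl | apply: pureDr | apply: pure_bal]. Qed.

Lemma tensor_ind (P : tensor -> Prop) :
  P 0 -> (forall x y t, P t -> P (pure x y + t)) -> forall t, P t.
Proof.
move=> P0 PD t; rewrite -(tensor_piK t); elim: (repr t) => [|[x y] s IHs] //.
by have := PD x y _ IHs; rewrite [_ + _]tensor_addE.
Qed.

End BalancedTensor.

Arguments pure {S M N ra la}.
Arguments lift {S M N ra la Z}.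

(** * Tensor products over a field *)

Section LinearTensor.
Variable k : fieldType.

Definition tens (M N : lmodType k) : Type :=
  tensor (fun (x : M) (a : k) => a *: x) (fun (a : k) (y : N) => a *: y).

HB.instance Definition _ (M N : lmodType k) := GRing.Zmodule.on (tens M N).

Definition otimes (M N : lmodType k) (x : M) (y : N) : tens M N := pure x y.

Definition tens_lift (M N : lmodType k) (Z : zmodType) (f : M -> N -> Z)
  (t : tens M N) : Z := lift f t.

Definition bilin (M N : lmodType k) (Z : zmodType) (f : M -> N -> Z) : Prop :=
  balanced (fun (x : M) (a : k) => a *: x) (fun (a : k) (y : N) => a *: y) f.

End LinearTensor.

Notation "x ⊗ y" := (otimes x y) (at level 40, left associativity) : ring_scope.

Section LinearTensorTheory.
Variable k : fieldType.

Section Module.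
Variables M N : lmodType k.

Lemma otimesDl (x x' : M) (y : N) : (x + x') ⊗ y = x ⊗ y + x' ⊗ y.
Proof. exact: pureDl. Qed.

Lemma otimesDr (x : M) (y y' : N) : x ⊗ (y + y') = x ⊗ y + x ⊗ y'.
Proof. exact: pureDr. Qed.

Lemma otimesZ (a : k) (x : M) (y : N) : (a *: x) ⊗ y = x ⊗ (a *: y).
Proof. by rewrite /otimes pure_bal. Qed.

Lemma tens_lift_otimes (Z : zmodType) (f : M -> N -> Z) : bilin f ->
  forall x y, tens_lift f (x ⊗ y) = f x y.
Proof. by move=> balf x y; apply: lift_pure. Qed.

Lemma tens_liftD (Z : zmodType) (f : M -> N -> Z) : bilin f ->
  forall t u, tens_lift f (t + u) = tens_lift f t + tens_lift f u.
Proof. by move=> balf t u; apply: liftD. Qed.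

Lemma tens_lift0 (Z : zmodType) (f : M -> N -> Z) : bilin f ->
  tens_lift f 0 = 0.
Proof.
move=> balf; apply: (addrI (tens_lift f 0)).
by rewrite -tens_liftD // !addr0.
Qed.

Lemma tens_ind (P : tens M N -> Prop) :
  P 0 -> (forall x y t, P t -> P (x ⊗ y + t)) -> forall t, P t.
Proof. exact: tensor_ind. Qed.

Lemma tens_ext (Z : zmodType) (f g : tens M N -> Z) :
    f 0 = g 0 ->
    (forall t u, f (t + u) = f t + f u) -> (forall t u, g (t + u) = g t + g u) ->
    (forall x y, f (x ⊗ y) = g (x ⊗ y)) -> forall t, f t = g t.
Proof.
move=> fg0 fD gD fg; elim/tens_ind => [|x y t IHt] //.
by rewrite fD gD fg IHt.
Qed.

Definition tens_scale (a : k) : tens M N -> tens M N :=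
  tens_lift (fun x y => (a *: x) ⊗ y).

Let bil_scale a : bilin (fun (x : M) (y : N) => (a *: x) ⊗ y).
Proof.
split=> [x x' y|x y y'|x b y].
- by rewrite scalerDr otimesDl.
- by rewrite otimesDr.
- by rewrite -otimesZ !scalerA mulrC.
Qed.

Let tens_scaleE a x y : tens_scale a (x ⊗ y) = (a *: x) ⊗ y.
Proof. by rewrite /tens_scale (tens_lift_otimes (bil_scale a)). Qed.

Fact tens_scaleDr : right_distributive tens_scale +%R.
Proof. by move=> a t u; apply: tens_liftD. Qed.

Let tens_scale0r a : tens_scale a 0 = 0.
Proof. exact: tens_lift0. Qed.

Fact tens_scaleA a b v : tens_scale a (tens_scale b v) = tens_scale (a * b) v.
Proof.
elim/tens_ind: v => [|x y t IHt]; first by rewrite !tens_scale0r.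
by rewrite !tens_scaleDr IHt !tens_scaleE scalerA.
Qed.

Fact tens_scale1 : left_id 1 tens_scale.
Proof.
elim/tens_ind => [|x y t IHt]; first by rewrite tens_scale0r.
by rewrite tens_scaleDr IHt tens_scaleE scale1r.
Qed.

Fact tens_scaleDl v : {morph tens_scale^~ v : a b / a + b}.
Proof.
move=> a b; elim/tens_ind: v => [|x y t IHt] /=.
  by rewrite !tens_scale0r addr0.
by rewrite !tens_scaleDr IHt !tens_scaleE scalerDl otimesDl addrACA.
Qed.

HB.instance Definition _ := GRing.Zmodule_isLmodule.Build k (tens M N)
  tens_scaleA tens_scale1 tens_scaleDr tens_scaleDl.

Lemma otimesZl (a : k) (x : M) (y : N) : (a *: x) ⊗ y = a *: (x ⊗ y).
Proof. by rewrite [RHS]tens_scaleE. Qed.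

Lemma otimesZr (a : k) (x : M) (y : N) : x ⊗ (a *: y) = a *: (x ⊗ y).
Proof. by rewrite -otimesZ otimesZl. Qed.

End Module.

Definition tens_map (M M' N N' : lmodType k) (f : M -> M') (g : N -> N') :
  tens M N -> tens M' N' := tens_lift (fun x y => f x ⊗ g y).

Definition tens_assoc (M N P : lmodType k) :
    tens (tens M N) P -> tens M (tens N P) :=
  tens_lift (fun t z => tens_lift (fun x y => x ⊗ (y ⊗ z)) t).

Lemma tens_map_otimes (M M' N N' : lmodType k)
    (f : {linear M -> M'}) (g : {linear N -> N'}) (x : M) (y : N) :
  tens_map f g (x ⊗ y) = f x ⊗ g y.
Proof.
rewrite /tens_map tens_lift_otimes //; split=> [u u' v|u v v'|u a v].
- by rewrite linearD otimesDl.
- by rewrite linearD otimesDr.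
- by rewrite !linearZ /= otimesZ.
Qed.

Lemma tens_assoc_otimes (M N P : lmodType k) (x : M) (y : N) (z : P) :
  tens_assoc ((x ⊗ y) ⊗ z) = x ⊗ (y ⊗ z).
Proof.
have bil (v : P) : bilin (fun (x : M) (y : N) => x ⊗ (y ⊗ v)).
  split=> [u u' w|u w w'|u a w]; first exact: otimesDl.
    by rewrite !otimesDl otimesDr.
  by rewrite otimesZ otimesZl.
rewrite /tens_assoc !tens_lift_otimes //.
split=> [t t' v|t v v'|t a v]; first by rewrite tens_liftD.
- elim/tens_ind: t => [|u w t IHt]; first by rewrite !tens_lift0 ?addr0.
  by rewrite !tens_liftD // IHt !tens_lift_otimes // !otimesDr addrACA.
- elim/tens_ind: t => [|u w t IHt]; first by rewrite scaler0 !tens_lift0.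
  rewrite scalerDr !tens_liftD // IHt -otimesZl !tens_lift_otimes //.
  by rewrite otimesZ -otimesZl otimesZ.
Qed.

Section Ring.
Variables M N : algType k.

Definition tens_one : tens M N := 1 ⊗ 1.
Definition tens_mul (t u : tens M N) : tens M N :=
  tens_lift (fun x y => tens_lift (fun x' y' => (x * x') ⊗ (y * y')) u) t.

Let bil_mul1 (x : M) (y : N) :
  bilin (fun (x' : M) (y' : N) => (x * x') ⊗ (y * y')).
Proof.
split=> [u u' v|u v v'|u b v].
- by rewrite mulrDr otimesDl.
- by rewrite mulrDr otimesDr.
- by rewrite -scalerAr -scalerAr otimesZ.
Qed.

Let bil_mul2 (u : tens M N) : bilin (fun (x : M) (y : N) =>
  tens_lift (fun x' y' => (x * x') ⊗ (y * y')) u).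
Proof.
split=> [x x' y|x y y'|x b y]; elim/tens_ind: u => [|z w u IHu];
  rewrite ?(tens_lift0 (bil_mul1 _ _)) ?addr0 //;
  rewrite !(tens_liftD (bil_mul1 _ _)) IHu !(tens_lift_otimes (bil_mul1 _ _)).
- by rewrite mulrDl otimesDl addrACA.
- by rewrite mulrDl otimesDr addrACA.
- by rewrite -!scalerAl otimesZ.
Qed.

Lemma tens_mulE x y x' y' :
  tens_mul (x ⊗ y) (x' ⊗ y') = (x * x') ⊗ (y * y').
Proof.
by rewrite /tens_mul (tens_lift_otimes (bil_mul2 _))
           (tens_lift_otimes (bil_mul1 _ _)).
Qed.

Fact tens_mulDl : left_distributive tens_mul +%R.
Proof. by move=> t t' u; rewrite /tens_mul (tens_liftD (bil_mul2 _)). Qed.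

Let tens_mul0l u : tens_mul 0 u = 0.
Proof. exact: tens_lift0 (bil_mul2 u). Qed.

Fact tens_mulDr : right_distributive tens_mul +%R.
Proof.
move=> t u u'; elim/tens_ind: t => [|x y t IHt].
  by rewrite !tens_mul0l addr0.
rewrite !tens_mulDl IHt addrACA; congr (_ + _).
by rewrite /tens_mul !(tens_lift_otimes (bil_mul2 _))
           (tens_liftD (bil_mul1 _ _)).
Qed.

Let tens_mul0r u : tens_mul u 0 = 0.
Proof. by apply: (addrI (tens_mul u 0)); rewrite -tens_mulDr !addr0. Qed.

Fact tens_mulA : associative tens_mul.
Proof.
move=> t u v; elim/tens_ind: t => [|x y t IHt]; first by rewrite !tens_mul0l.
rewrite !tens_mulDl IHt; congr (_ + _).
elim/tens_ind: u {t IHt} => [|x' y' u IHu].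
  by rewrite tens_mul0l !tens_mul0r tens_mul0l.
rewrite !(tens_mulDl, tens_mulDr) IHu; congr (_ + _).
elim/tens_ind: v {u IHu} => [|z w v IHv]; first by rewrite !tens_mul0r.
by rewrite !tens_mulDr IHv !tens_mulE !mulrA.
Qed.

Fact tens_mul1l : left_id tens_one tens_mul.
Proof.
elim/tens_ind => [|x y t IHt]; first exact: tens_mul0r.
by rewrite tens_mulDr IHt tens_mulE !mul1r.
Qed.

Fact tens_mul1r : right_id tens_one tens_mul.
Proof.
elim/tens_ind => [|x y t IHt]; first exact: tens_mul0l.
by rewrite tens_mulDl IHt tens_mulE !mulr1.
Qed.

(* Only a possibly zero ring: [nzRingType] would require 1 ⊗ 1 != 0. *)
HB.instance Definition _ := GRing.Zmodule_isPzRing.Build (tens M N)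
  tens_mulA tens_mul1l tens_mul1r tens_mulDl tens_mulDr.

Lemma otimesM (x x' : M) (y y' : N) :
  (x ⊗ y) * (x' ⊗ y') = (x * x') ⊗ (y * y').
Proof. exact: tens_mulE. Qed.

Lemma otimes1 : (1 : M) ⊗ (1 : N) = 1.
Proof. by []. Qed.

Lemma tens_scalerAl (a : k) (t u : tens M N) : a *: (t * u) = (a *: t) * u.
Proof.
elim/tens_ind: t => [|x y t IHt]; first by rewrite mul0r scaler0 mul0r.
rewrite mulrDl !scalerDr mulrDl IHt; congr (_ + _) => {t IHt}.
elim/tens_ind: u => [|x' y' u IHu]; first by rewrite !mulr0 scaler0.
rewrite !mulrDr scalerDr IHu; congr (_ + _).
by rewrite -otimesZl !otimesM -scalerAl -otimesZl.
Qed.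

End Ring.
End LinearTensorTheory.

(** * Hopf algebras and comodule algebras *)

Record hopfAlgebra (k : fieldType) := HopfAlgebra {
  hopf_sort :> falgType k;
  comul : {lrmorphism hopf_sort -> tens hopf_sort hopf_sort};
  counit : {lrmorphism hopf_sort -> k | *%R};
  antipode : {linear hopf_sort -> hopf_sort};
  comulA : forall h, tens_assoc (tens_map comul id (comul h)) =
                     tens_map id comul (comul h);
  comul_counitl : forall h,
    tens_lift (fun h1 h2 => counit h1 *: h2) (comul h) = h;
  comul_counitr : forall h,
    tens_lift (fun h1 h2 => counit h2 *: h1) (comul h) = h;
  comul_antipodel : forall h,
    tens_lift (fun h1 h2 => antipode h1 * h2) (comul h) = (counit h)%:A;
  comul_antipoder : forall h,
    tens_lift (fun h1 h2 => h1 * antipode h2) (comul h) = (counit h)%:A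
}.

(* Complete reducibility of the left regular module: every left ideal is a
   direct summand. *)
Definition semisimple (k : fieldType) (H : falgType k) : Prop :=
  forall I : {vspace H}, (fullv * I <= I)%VS ->
  exists J : {vspace H},
    [/\ (fullv * J <= J)%VS, (I + J)%VS = fullv & (I :&: J)%VS = 0%VS].

Record comodAlgebra (k : fieldType) (H : hopfAlgebra k) := ComodAlgebra {
  comod_sort :> algType k;
  coact : {lrmorphism comod_sort -> tens comod_sort H};
  coactA : forall b, tens_assoc (tens_map coact id (coact b)) =
                     tens_map id (@comul k H) (coact b);
  coact_counit : forall b,
    tens_lift (fun b0 b1 => counit H b1 *: b0) (coact b) = b
}.

Section Coinvariants.
Variables (k : fieldType) (H : hopfAlgebra k) (B : comodAlgebra H).

Definition coinv_pred : {pred B} := fun b => coact B b == b ⊗ 1.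

Fact coinv_closed : GRing.subsemialg_closed coinv_pred.
Proof.
have E b : (b \in coinv_pred) = (coact B b == b ⊗ 1) by [].
split.
- by rewrite E rmorph1.
- split=> [|x y]; rewrite !E.
    by rewrite rmorph0 -[X in X ⊗ _](scale0r (0 : B)) otimesZl scale0r.
  by move=> /eqP hx /eqP hy; rewrite raddfD /= hx hy otimesDl.
- by move=> a x; rewrite !E => /eqP hx; rewrite linearZ /= hx otimesZl.
- by move=> x y; rewrite !E => /eqP hx /eqP hy;
    rewrite rmorphM /= hx hy otimesM mulr1.
Qed.

Record coinv := Coinv { coinv_val :> B; _ : coinv_val \in coinv_pred }.
HB.instance Definition _ := [isSub for coinv_val].
HB.instance Definition _ := [Choice of coinv by <:].
HB.instance Definition _ := GRing.SubChoice_isSubAlgebra.Build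
  k B coinv_pred coinv coinv_closed.
HB.instance Definition _ := GRing.isLinear.Build k coinv B *:%R coinv_val
  (linearP (val : coinv -> B)).
HB.instance Definition _ := GRing.isMonoidMorphism.Build coinv B coinv_val
  (rmorphism_monoidP (val : coinv -> B)).

(* B ⊗_A B for A the algebra of coinvariants. *)
Definition tens_coinv : Type :=
  tensor (fun (b : B) (a : coinv) => b * coinv_val a)
         (fun (a : coinv) (b : B) => coinv_val a * b).
HB.instance Definition _ := GRing.Zmodule.on tens_coinv.

Definition galois_map : tens_coinv -> tens B H :=
  lift (fun b' b => tens_lift (fun b0 b1 => (b' * b0) ⊗ b1) (coact B b)).

Definition Hopf_Galois : Prop := bijective galois_map.

Let bil_galois (b' : B) : bilin (fun (b0 : B) (b1 : H) => (b' * b0) ⊗ b1).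
Proof.
split=> [x x' y|x y y'|x a y].
- by rewrite mulrDr otimesDl.
- by rewrite otimesDr.
- by rewrite -scalerAr otimesZ.
Qed.

Lemma galois_innerE (b' : B) (t : tens B H) :
  tens_lift (fun b0 b1 => (b' * b0) ⊗ b1) t = (b' ⊗ 1) * t.
Proof.
elim/tens_ind: t => [|x y t IHt].
  by rewrite mulr0 (tens_lift0 (bil_galois b')).
rewrite mulrDr -IHt (tens_liftD (bil_galois b')).
by rewrite (tens_lift_otimes (bil_galois b')) otimesM mul1r.
Qed.

Lemma galois_map_balanced : balanced
  (fun (b : B) (a : coinv) => b * coinv_val a)
  (fun (a : coinv) (b : B) => coinv_val a * b)
  (fun b' b => tens_lift (fun b0 b1 => (b' * b0) ⊗ b1) (coact B b)).
Proof.
split=> [x x' y|x y y'|x a y]; rewrite !galois_innerE.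
- by rewrite otimesDl mulrDl.
- by rewrite raddfD mulrDr.
- have /eqP ha : coinv_val a \in coinv_pred by case: a.
  by rewrite rmorphM /= ha mulrA otimesM mulr1.
Qed.

Lemma galois_map_pure (b' b : B) :
  galois_map (pure b' b) =
  tens_lift (fun b0 b1 => (b' * b0) ⊗ b1) (coact B b).
Proof. by rewrite /galois_map lift_pure //; apply: galois_map_balanced. Qed.

End Coinvariants.

(** * Free modules, traces and discriminants *)

(* [z] is a basis of [M] for the action [act] of [S], which may be a left or a
   right action. *)
Definition free_basis (S : choiceType) (M : nmodType) (act : S -> M -> M)
    (n : nat) (z : 'I_n -> M) : Prop :=
  forall x, exists! c : {ffun 'I_n -> S}, x = \sum_i act (c i) (z i).

(* [iota] embeds R as a central subalgebra of C, and C is an R-module through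
   left multiplication by [iota r]. *)
Section Discriminant.
Variables (R : comNzRingType) (C : nzRingType) (iota : R -> C).

Definition sub_act (r : R) (c : C) : C := iota r * c.

(* The coordinates of x in z; meaningful when z is a basis. *)
Definition coords n (z : 'I_n -> C) (x : C) : {ffun 'I_n -> R} :=
  xget [ffun=> 0] [set c | x = \sum_i sub_act (c i) (z i)]%classic.

Definition lmul_mx n (z : 'I_n -> C) (c : C) : 'M[R]_n :=
  \matrix_(i, j) coords z (c * z j) i.

(* Computed in the basis z, but independent of it: lemma [hs_trace_basis]. *)
Definition hs_trace n (z : 'I_n -> C) (c : C) : R := \tr (lmul_mx z c).

Definition discr n (z : 'I_n -> C) : R :=
  \det (\matrix_(i, j) hs_trace z (z i * z j)).

End Discriminant.

Section DiscriminantTheory.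
Variables (R : comNzRingType) (C : nzRingType) (iota : {rmorphism R -> C}).
Hypothesis iota_central : forall r c, iota r * c = c * iota r.

Lemma coordsP n (z : 'I_n -> C) : free_basis (sub_act iota) z ->
  forall x, x = \sum_i sub_act iota (coords iota z x i) (z i).
Proof.
move=> bz x; have [c [hc _]] := bz x; rewrite /coords.
by case: xgetP => [d _ //|/(_ c)]; case.
Qed.

Lemma coords_unique n (z : 'I_n -> C) : free_basis (sub_act iota) z ->
  forall x c, x = \sum_i sub_act iota (c i) (z i) ->
  forall i, c i = coords iota z x i.
Proof.
move=> bz x c hc i; have [d [_ du]] := bz x.
rewrite -(du _ (coordsP bz x)) (du [ffun j => c j]) ?ffunE //.
by rewrite hc; apply: eq_bigr => j _; rewrite ffunE.
Qed.

Lemma hs_trace_basis n n' (z : 'I_n -> C) (z' : 'I_n' -> C) :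
    free_basis (sub_act iota) z -> free_basis (sub_act iota) z' ->
  forall c, hs_trace iota z c = hs_trace iota z' c.
Proof.
move=> bz bz' c.
pose P := \matrix_(i < n', j < n) coords iota z' (z j) i.
pose Q := \matrix_(i < n, j < n') coords iota z (z' j) i.
have sum2 p q (u : 'I_p -> C) (v : 'I_q -> C) (f : C -> C)
    (hf : forall r x, f (sub_act iota r x) = sub_act iota r (f x))
    (fD : forall I (s : seq I) F, f (\sum_(i <- s) F i) = \sum_(i <- s) f (F i)) :
    free_basis (sub_act iota) u -> free_basis (sub_act iota) v ->
    forall x i, coords iota v (f x) i =
      \sum_j coords iota v (f (u j)) i * coords iota u x j.
  move=> bu bv x i; symmetry.
  apply: (coords_unique bv (c := fun i => \sum_j _)).
  rewrite {1}(coordsP bu x) fD.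
  under [RHS]eq_bigr => l _ do rewrite /sub_act raddf_sum mulr_suml.
  rewrite [RHS]exchange_big; apply: eq_bigr => j _ /=.
  rewrite hf {1}(coordsP bv (f (u j))) /sub_act mulr_sumr.
  by apply: eq_bigr => l _; rewrite mulrA -rmorphM mulrC.
have idD I (s : seq I) (F : I -> C) :
  id (\sum_(i <- s) F i) = \sum_(i <- s) id (F i) by [].
have cD I (s : seq I) (F : I -> C) :
  c * (\sum_(i <- s) F i) = \sum_(i <- s) c * F i by rewrite mulr_sumr.
have cZ r x : c * sub_act iota r x = sub_act iota r (c * x).
  by rewrite /sub_act mulrA -iota_central mulrA.
have E1 : lmul_mx iota z' c *m P = P *m lmul_mx iota z c.
  apply/matrixP=> i j; rewrite !mxE.
  under eq_bigr => l _ do rewrite !mxE.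
  under [RHS]eq_bigr => l _ do rewrite !mxE.
  by rewrite -(sum2 _ _ _ _ _ cZ cD bz' bz') -(sum2 _ _ _ _ id _ idD bz bz').
have E2 : P *m Q = 1%:M.
  apply/matrixP=> i j; rewrite !mxE.
  under eq_bigr => l _ do rewrite !mxE.
  rewrite -(sum2 _ _ _ _ id _ idD bz bz') //; symmetry.
  apply: (coords_unique bz' (c := fun i => (i == j)%:R)).
  rewrite (bigD1 j) //= eqxx /sub_act rmorph1 mul1r big1 ?addr0 // => l /negbTE->.
  by rewrite rmorph0 mul0r.
have E3 : Q *m P = 1%:M.
  apply/matrixP=> i j; rewrite !mxE.
  under eq_bigr => l _ do rewrite !mxE.
  rewrite -(sum2 _ _ _ _ id _ idD bz' bz) //; symmetry.
  apply: (coords_unique bz (c := fun i => (i == j)%:R)).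
  rewrite (bigD1 j) //= eqxx /sub_act rmorph1 mul1r big1 ?addr0 // => l /negbTE->.
  by rewrite rmorph0 mul0r.
rewrite /hs_trace -[LHS](congr1 mxtrace (mul1mx _)) -E3 -mulmxA -E1.
by rewrite mxtrace_mulC -mulmxA E2 mulmx1.
Qed.

(* A free extension of a free algebra is free, so that B has an R-basis. *)
Lemma free_basis_tower (A : nzRingType) (j : {rmorphism A -> C})
    (iotaA : {rmorphism R -> A}) n m (z : 'I_n -> A) (w : 'I_m -> C) :
    (forall r, j (iotaA r) = iota r) ->
    free_basis (sub_act iotaA) z ->
    free_basis (fun (a : A) (b : C) => b * j a) w ->
  exists y : 'I_#|{: 'I_m * 'I_n}| -> C, free_basis (sub_act iota) y.
Proof.
move=> jE bz bw.
exists (fun l => let p := enum_val l in w p.1 * j (z p.2)) => x.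
have sumE (c : {ffun 'I_#|{: 'I_m * 'I_n}| -> R}) :
    \sum_l sub_act iota (c l) (let p := enum_val l in w p.1 * j (z p.2)) =
    \sum_i w i * j (\sum_l sub_act iotaA (c (enum_rank (i, l))) (z l)).
  rewrite (reindex enum_rank) /=; last first.
    by apply: onW_bij; apply: enum_rank_bij.
  under eq_bigr => p _ do rewrite enum_rankK.
  under [RHS]eq_bigr => i _ do rewrite raddf_sum mulr_sumr.
  rewrite pair_big /=; apply: eq_bigr => -[i l] _ /=.
  by rewrite /sub_act rmorphM jE !mulrA iota_central.
have [a [xE ua]] := bw x.
have /choice [e he] : forall i, exists c : {ffun 'I_n -> R},
    a i = \sum_l sub_act iotaA (c l) (z l) /\
    forall c' : {ffun 'I_n -> R},
      a i = \sum_l sub_act iotaA (c' l) (z l) -> c = c'.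
  by move=> i; have [c [hc uc]] := bz (a i); exists c; split=> // c' /uc.
exists [ffun l => let p := enum_val l in e p.1 p.2]; split.
  rewrite sumE xE; apply: eq_bigr => i _; rewrite (he i).1.
  by congr (_ * j _); apply: eq_bigr => l _; rewrite ffunE enum_rankK.
move=> c; rewrite sumE => xc; apply/ffunP=> l; rewrite ffunE.
case: (enum_val l) (enum_valK l) => i l' <- /=.
pose a' := [ffun i => \sum_l sub_act iotaA (c (enum_rank (i, l))) (z l)].
have ai : a i = a' i.
  by rewrite (ua a') // xc; apply: eq_bigr => q _; rewrite ffunE.
rewrite ((he i).2 [ffun l => c (enum_rank (i, l))]) ?ffunE // ai ffunE.
by apply: eq_bigr => q _; rewrite ffunE.
Qed.

End DiscriminantTheory.

Definition eq_up_to_unit (R : comNzRingType) (x y : R) : Prop :=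
  exists u v : R, u * v = 1 /\ x = u * y.

(* Main.v *)
(* Idea.  H is involutive (Larson-Radford), so the regular trace f of H is both
   symmetric and an integral of the dual; normalize the integral L of H by
   eps L = 1.  Then E(b) = b_0 f(b_1) is an A-bimodule map from B to A, and the
   preimage sum x ⊗ y of 1 ⊗ L under the Galois map satisfies
   sum x E(y b) = b = sum E(b x) y and sum x y = 1.  Hence B is a Frobenius
   extension of A: the right A-basis w has a dual left A-basis w' with
   E(w'_i w_l) = delta_il and sum w_i w'_i = 1.

   Write tr_A, tr_B for the traces over R.  Since w' is a left basis,
   tr_B(a) = m tr_A(a) on A; since w is a right basis,
   tr_B(b) = sum tr_A(E(w'_i b w_i)).  As tr_B and f are symmetric,
   tr_B(E(x y)) = tr_B(E(y x)), so m tr_B(b) = sum tr_B(E(b w_i w'_i)) =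
   tr_B(E(b)) = m tr_A(E(b)), whence tr_B = tr_A o E.  The Gram matrix of tr_B
   with respect to the R-bases (z_p w'_i) and (w_i z_q) of B is thus block
   diagonal, with m copies of the Gram matrix of tr_A for z.

   For the involutivity of H, let lam(y) be the trace of h |-> S^2(h) y.  It is an
   integral of the dual with lam L = 1; comparing it with lam o S gives
   S^4 = conjugation by a group-like g of finite order, and comparing it with the
   regular character shows that S^2 is conjugation by some v.  If
   lam(1) = tr(S^2) were 0, then decomposing H over a splitting field into joint
   eigenspaces of central elements would exhibit 0 as a positive combination of
   squared moduli of sums of roots of unity, not all of them 0.  So g = 1
   and S^4 = 1; finally the regular character is dim H times an idempotent of the
   dual that commutes with S^2, and the trace of S^2 on its image is
   tr(S^2) / dim H.  All these traces are integers, which forces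
   tr(S^2) = dim H. *)
Require Import Defs.
From HB Require Import structures.
From mathcomp Require Import all_boot all_order all_algebra all_field.
From mathcomp Require Import boolp.

Set Implicit Arguments.
Unset Strict Implicit.
Unset Printing Implicit Defensive.

Import Order.TTheory GRing.Theory Num.Theory.
Local Open Scope ring_scope.

(** * A positivity property of traces *)

Lemma intr_eq0_pchar0 (L : fieldType) (c : int) :
  [pchar L] =i pred0 -> (c%:~R == 0 :> L) = (c == 0).
Proof.
move=> ch0; case: c => n; rewrite ?NegzE ?rmorphN /= ?oppr_eq0.
  exact: (pcharf0P L).1 ch0 n.
exact: (pcharf0P L).1 ch0 n.+1.
Qed.

Lemma natr_inj_pchar0 (L : fieldType) :
  [pchar L] =i pred0 -> injective (fun n : nat => n%:R : L).
Proof.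
move=> ch0 m n E; apply/eqP; rewrite -eqz_nat -subr_eq0.
by rewrite -(intr_eq0_pchar0 _ ch0) rmorphB /= -!pmulrn E subrr.
Qed.

Lemma exists_irreducible_dvdp (k : fieldType) (p : {poly k}) :
  (1 < size p)%N -> exists2 q, irreducible_poly q & q %| p.
Proof.
move=> sp.
have ex : exists n, `[< exists q, [/\ q %| p, (1 < size q)%N & size q = n] >].
  by exists (size p); apply/asboolP; exists p; split.
case: (ex_minnP ex) => n /asboolP[q [qp sq <-]] minq; exists q => //.
have q0 : q != 0 by rewrite -size_poly_gt0 ltnW.
split=> // r sr rq; rewrite -dvdp_size_eqp //.
have r0 : r != 0 by apply: contraTneq rq => ->; rewrite dvd0p.
rewrite eqn_leq dvdp_leq //= minq //; apply/asboolP; exists r; split=> //.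
  exact: dvdp_trans rq qp.
by rewrite ltn_neqAle eq_sym sr size_poly_gt0.
Qed.

(** Induction on the degree: adjoin a root of an irreducible factor and split the cofactor. The
    induction quantifies over [k] too, since the base field changes at each step. *)
Lemma splitting_extension (k : fieldType) (p : {poly k}) : p != 0 ->
  exists (L : fieldType) (f : {rmorphism k -> L}) (rs : seq L),
    map_poly f p %= \prod_(x <- rs) ('X - x%:P).
Proof.
have [n] := ubnP (size p); elim: n k p => // n IHn k p; rewrite ltnS => sp p0.
have [sp1|sp1] := leqP (size p) 1.
  exists k, idfun, [::]; rewrite big_nil map_poly_id //.
  by rewrite -size_poly_eq1 eqn_leq sp1 size_poly_gt0.
have [q irrq qp] := exists_irreducible_dvdp sp1.
have [L _ [z rz _]] := irredp_FAdjoin irrq.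
pose i : {rmorphism k -> L} := in_alg L.
have : root (map_poly i p) z.
  by case/dvdpP: qp => u ->; rewrite rmorphM rootM rz orbT.
case/factor_theorem => p1 Ep.
have ip0 : map_poly i p != 0 by rewrite map_poly_eq0.
have p10 : p1 != 0 by apply: contraNneq ip0 => p10; rewrite Ep p10 mul0r.
have [|L' [f [rs Ef]]] := IHn L p1 _ p10.
  rewrite -(size_map_poly i) Ep size_mul ?polyXsubC_eq0 // size_XsubC in sp.
  by move: sp; rewrite addn2.
exists L', (f \o i : {rmorphism k -> L'}), (f z :: rs).
rewrite map_poly_comp Ep rmorphM /= map_polyXsubC big_cons mulrC.
by rewrite eqp_mul2l ?polyXsubC_eq0.
Qed.

(** Since X^n - 1 is the product of the cyclotomic polynomials of the divisors d of n, [z] is a root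
    of one of them, hence z^d = 1, and primitivity forces d = n. *)
Lemma root_Cyclotomic (L : fieldType) (n : nat) (z : L) :
  n.-primitive_root z -> root (map_poly intr 'Phi_n : {poly L}) z.
Proof.
move=> prz; have n0 := prim_order_gt0 prz.
have := congr1 (map_poly (intr : int -> L)) (prod_Cyclotomic n0).
rewrite rmorph_prod rmorphB /= map_polyXn rmorph1 => E.
have : root ('X^n - 1 : {poly L}) z.
  by rewrite -[X in root X _]/('X^n - 1%:P) rootE !hornerE (prim_expr_order prz) subrr.
rewrite -E rootE horner_prod prodf_seq_eq0 => /hasP[d dn /= rd].
suff -> : n = d by [].
rewrite -dvdn_divisors // in dn.
apply/eqP; rewrite eqn_dvd dn andbT (prim_order_dvd prz) -subr_eq0.
have d0 : (0 < d)%N := dvdn_gt0 n0 dn.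
have := congr1 (map_poly (intr : int -> L)) (prod_Cyclotomic d0).
rewrite rmorph_prod rmorphB /= map_polyXn rmorph1.
rewrite (bigD1_seq d) ?divisors_uniq -?dvdn_divisors //=.
move/(congr1 (fun q => q.[z])).
by rewrite hornerM (eqP rd) mul0r -[X in _ = (_ - X).[_] -> _]/(1%:P) !hornerE => <-.
Qed.

(* The cyclotomic polynomial is irreducible over Q, hence either divides p, or
   is coprime to p, in which case some nonzero integer is a combination of
   both; the latter excludes p(z) = 0. *)
Lemma root_intr_prim_transfer (L L' : fieldType) (n : nat) (z : L) (z' : L')
    (p : {poly int}) :
  [pchar L] =i pred0 -> [pchar L'] =i pred0 ->
  n.-primitive_root z -> n.-primitive_root z' ->
  root (map_poly intr p) z -> root (map_poly intr p) z'.
Proof.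
move=> ch0 ch0' prz prz' rz.
have [w prw] := C_prim_root_exists (prim_order_gt0 prz).
have [q [Eq [monq minq]]] := minCpolyP w.
have inQ (r : {poly int}) : map_poly (ratr : rat -> algC) (map_poly intr r) = map_poly intr r.
  by rewrite -map_poly_comp; apply: eq_map_poly => x /=; rewrite rmorph_int.
have {}Eq : q = map_poly intr 'Phi_n.
  apply: (map_poly_inj (ratr : {rmorphism rat -> algC})).
  by rewrite inQ (Cintr_Cyclotomic prw) -Eq (minCpoly_cyclotomic prw).
have rw : root (map_poly (ratr : rat -> algC) q) w by rewrite minq.
pose pQ : {poly rat} := map_poly intr p.
have clear (r : {poly rat}) : exists (a : int) (s : {poly int}),
    a != 0 /\ a%:~R *: r = map_poly intr s.
  have [s [a a0 ->]] := rat_poly_scale r; exists a, s; split=> //.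
  by rewrite scalerA mulfV ?intr_eq0 // scale1r.
have injQ (r s : {poly int}) : map_poly (intr : int -> rat) r = map_poly intr s -> r = s.
  by move=> E; apply/polyP=> i; have /polyP/(_ i) := E; rewrite !coef_map; apply: intr_inj.
have [/dvdpP[u Eu]|ndvd] := boolP (q %| pQ).
  have [a [s [a0 Es]]] := clear u.
  have E : a *: p = s * 'Phi_n.
    apply: injQ; rewrite rmorphM /= -Es -scalerAl -Eq -Eu.
    by apply/polyP=> i; rewrite !(coefZ, coef_map) /= rmorphM.
  have := congr1 (fun r => (map_poly (intr : int -> L') r).[z']) E.
  rewrite /= rmorphM hornerM (eqP (root_Cyclotomic prz')) mulr0.
  rewrite linearZ_LR /= hornerZ => /eqP.
  by rewrite mulf_eq0 intr_eq0_pchar0 // (negbTE a0).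
have : coprimep pQ q.
  (* Write q = h * gcd(p, q). If [w] is a root of h, then q divides h and the gcd is constant by
     degree; if it is a root of the gcd, then q divides p, which is excluded. *)
  rewrite /coprimep; case/dvdpP: (dvdp_gcdr pQ q) => h Eh.
  have q0 : q != 0 by rewrite monic_neq0.
  move: rw; rewrite {1}Eh rmorphM rootM !minq => /orP[qh|qg].
    have h0 : h != 0 by apply: contraNneq q0 => h0; rewrite Eh h0 mul0r.
    have g0 : gcdp pQ q != 0 by apply: contraNneq q0 => g0; rewrite Eh g0 mulr0.
    have := dvdp_leq h0 qh; rewrite {1}Eh size_mul //.
    move: g0; rewrite -size_poly_gt0; case: (size (gcdp _ _)) => [|[|g]] // _.
    by rewrite !addnS /= ltnNge leq_addr.
  by rewrite (dvdp_trans qg (dvdp_gcdl _ _)) in ndvd.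
case/Bezout_eq1_coprimepP => -[u v] /= Euv.
have [a [s [a0 Es]]] := clear u; have [b [t [b0 Et]]] := clear v.
have E : (b *: s) * p + (a *: t) * 'Phi_n = (a * b)%:P.
  apply: injQ; rewrite rmorphD !rmorphM /= !map_polyC /= !linearZ_LR /=.
  rewrite -Es -Et -Eq -/pQ !scalerA [b%:~R * _]mulrC.
  by rewrite -!scalerAl -scalerDr Euv -!mul_polyC mulr1 polyCM.
have := congr1 (fun r => (map_poly (intr : int -> L) r).[z]) E.
rewrite /= rmorphD !rmorphM /= hornerD !hornerM (eqP rz) (eqP (root_Cyclotomic prz)).
rewrite !mulr0 addr0 !map_polyC !hornerC => /esym/eqP.
by rewrite mulf_eq0 !intr_eq0_pchar0 // (negbTE a0) (negbTE b0).
Qed.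

(** Interpolation: by linearity the sum of c t p(x t) q(y t) vanishes for all polynomials p and q,
    in particular for p vanishing at the values of [x] other than [x s] and q likewise for [y]. *)
Lemma sum_joint_fiber_eq0 (L : fieldType) (n : nat) (c x y : 'I_n -> L) :
  (forall i j, \sum_t c t * (x t ^+ i * y t ^+ j) = 0) ->
  forall s, \sum_(t | (x t == x s) && (y t == y s)) c t = 0.
Proof.
move=> h s.
have hp (p q : {poly L}) : \sum_t c t * (p.[x t] * q.[y t]) = 0.
  under eq_bigr => t _ do
    rewrite !horner_coef big_distrlr mulr_sumr /=.
  rewrite exchange_big big1 //= => i _.
  under eq_bigr => t _ do rewrite mulr_sumr.
  rewrite exchange_big big1 //= => j _.
  under eq_bigr => t _ do rewrite (mulrACA p`_i) (mulrCA (c t)).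
  by rewrite -mulr_sumr h mulr0.
pose P (u : 'I_n -> L) := \prod_(t | u t != u s) ('X - (u t)%:P).
have P0 u t : u t != u s -> (P u).[u t] = 0.
  by move=> ut; rewrite horner_prod (bigD1 t) //= !hornerE subrr mul0r.
have P1 u : (P u).[u s] != 0.
  rewrite horner_prod; apply/prodf_neq0 => t ut.
  by rewrite !hornerE subr_eq0 eq_sym.
have := hp (P x) (P y); rewrite (bigID (fun t => (x t == x s) && (y t == y s))) /=.
rewrite [X in _ + X]big1 ?addr0 => [|t]; last first.
  by rewrite negb_and => /orP[] /P0 ->; rewrite ?(mul0r, mulr0).
rewrite (eq_bigr (fun t => c t * ((P x).[x s] * (P y).[y s]))); last first.
  by move=> t /andP[/eqP-> /eqP->].
by rewrite -mulr_suml => /eqP; rewrite mulf_eq0 mulf_eq0 !(negbTE (P1 _)) !orbF => /eqP.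
Qed.

(* Let u ~ t mean al u = al t and nu u ^+ N = nu t ^+ N.  The trace hypothesis
   makes al t the average of nu over the class of t, so that the vanishing sum
   is the sum of the nu u / (d t * nu t) over u ~ t, where d t is the size of the
   class of t.  The quotients nu u / nu t are roots of unity, and over the complex
   numbers this is a sum of squared moduli. *)
Lemma trace_sum_eq0 (L : fieldType) (n N : nat) (z : L) (al nu : 'I_n -> L) :
  [pchar L] =i pred0 -> N.-primitive_root z -> (forall t, nu t != 0) ->
  (forall i j, \sum_t nu t * (al t ^+ i * (nu t ^+ N) ^+ j) =
               \sum_t al t * (al t ^+ i * (nu t ^+ N) ^+ j)) ->
  \sum_t al t / nu t = 0 -> forall t, al t = 0.
Proof.
move=> ch0 prz nu0 htr sum0.
have N0 := prim_order_gt0 prz.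
have nat0 := (pcharf0P L).1 ch0.
pose eqv t u := (al u == al t) && (nu u ^+ N == nu t ^+ N).
have eqvxx t : eqv t t by rewrite /eqv !eqxx.
have eqvC t u : eqv t u = eqv u t by rewrite /eqv [al u == _]eq_sym [_ ^+ N == _]eq_sym.
have eqvE t u : eqv t u -> eqv t =1 eqv u.
  by move=> /andP[/eqP e1 /eqP e2] v; rewrite /eqv e1 e2.
pose d t := #|[pred u | eqv t u]|.
have d0 t : (0 < d t)%N by apply/card_gt0P; exists t; rewrite inE.
have dE t u : eqv t u -> d u = d t by move=> e; apply: eq_card => v; rewrite !inE (eqvE _ _ e).
have avg t : \sum_(u | eqv t u) nu u = (d t)%:R * al t.
  have : \sum_(u | eqv t u) (nu u - al u) = 0.
    apply: (sum_joint_fiber_eq0 (x := al) (y := fun u => nu u ^+ N)) => i j.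
    under eq_bigr => u _ do rewrite mulrBl.
    by rewrite sumrB htr subrr.
  rewrite sumrB => /eqP; rewrite subr_eq0 => /eqP ->.
  rewrite (eq_bigr (fun=> al t)) => [|u /andP[/eqP-> _]//].
  by rewrite sumr_const mulr_natl.
(* The pick depends only on the predicate [eqv t], so [rep] is constant on each class. *)
pose rep t := odflt t [pick u | eqv t u].
have repP t : eqv t (rep t) by rewrite /rep; case: pickP.
have repE t u : eqv t u -> rep t = rep u.
  move=> e; rewrite /rep (eq_pick (eqvE _ _ e)); case: pickP => // /(_ u).
  by rewrite eqvxx.
have kP t : {i : 'I_N | nu t = nu (rep t) * z ^+ i}.
  have [|i Ei] := prim_rootP prz (x := nu t / nu (rep t)).
    have /andP[_ /eqP e] := repP t.
    by rewrite exprMn exprVn e mulfV // expf_neq0.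
  by exists i; rewrite -Ei mulrC divfK.
pose k t := sval (kP t).
have kE t : nu t = nu (rep t) * z ^+ k t by rewrite /k; case: (kP t).
have prim_neq0 (F : fieldType) (x : F) : N.-primitive_root x -> x != 0.
  move=> /prim_expr_order; apply: contra_eq_neq => ->.
  by rewrite expr0n (gtn_eqF N0) eq_sym oner_neq0.
have z0 := prim_neq0 _ _ prz.
have zV i : (i <= N)%N -> (z ^+ i)^-1 = z ^+ (N - i).
  move=> iN; apply: (mulfI (x := z ^+ i)).
    by rewrite expf_neq0 // (primitive_root_eq0 prz) -lt0n.
  rewrite mulfV ?expf_neq0 ?(primitive_root_eq0 prz) -?lt0n //.
  by rewrite -exprD subnKC // (prim_expr_order prz).
have [w prw] := C_prim_root_exists N0.
have chC : [pchar algC] =i pred0 by apply: pchar_num.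
(* Multiplying by n! clears the class sizes, so that the vanishing sum is the value at [z] of the
   integer polynomial [p] below; the exponent [N - k t] encodes the inverse of [z ^+ k t]. *)
pose D t := (n`! %/ d t)%N.
have DE t : (D t * d t)%N = n`!.
  rewrite divnK // dvdn_fact // d0 /=.
  by rewrite -[X in (_ <= X)%N](card_ord n) max_card.
pose W t : {poly int} := \sum_(u | eqv t u) 'X^(k u).
pose p : {poly int} := \sum_t (D t)%:R * (W t * 'X^(N - k t)).
have hW (F : fieldType) (x : F) t :
    (map_poly intr (W t)).[x] = \sum_(u | eqv t u) x ^+ k u.
  rewrite rmorph_sum horner_sum; apply: eq_bigr => u _.
  by rewrite /= map_polyXn hornerXn.
have hp (F : fieldType) (x : F) : (map_poly intr p).[x] =
    \sum_t (D t)%:R * ((\sum_(u | eqv t u) x ^+ k u) * x ^+ (N - k t)).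
  rewrite rmorph_sum horner_sum; apply: eq_bigr => u _.
  by rewrite /= !rmorphM /= rmorph_nat map_polyXn !hornerM hW hornerXn -mulr_natl mulr1 hornerMn hornerC.
have rz : root (map_poly intr p) z.
  rewrite rootE hp; apply/eqP.
  transitivity (n`!%:R * \sum_t al t / nu t); last by rewrite sum0 mulr0.
  rewrite mulr_sumr.
  apply: eq_bigr => t _.
  rewrite -zV ?(ltnW (ltn_ord _)) // -(DE t) natrM -!mulrA; congr (_ * _).
  rewrite [RHS]mulrA -avg !mulr_suml; apply: eq_bigr => u e.
  by rewrite (kE t) [nu u]kE (repE t u e) invfM mulrACA mulfV ?mul1r.
have := root_intr_prim_transfer ch0 chC prz prw rz.
rewrite rootE hp => /eqP sumC.
pose V t := \sum_(u | eqv t u) w ^+ k u.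
have VE t u : eqv t u -> V t = V u by move=> e; apply: eq_bigl => v; apply: eqvE.
have wV t : w ^+ (N - k t) = (w ^+ k t)^*.
  have w0 := prim_neq0 _ _ prw.
  apply: (mulfI (x := w ^+ k t)); first by rewrite expf_neq0.
  rewrite -exprD subnKC ?(ltnW (ltn_ord _)) // (prim_expr_order prw) -normCK.
  have -> : `|w ^+ k t| = 1; last by rewrite expr1n.
  apply/eqP; rewrite -(pexpr_eq1 N0) ?normr_ge0 // -normrX exprAC.
  by rewrite (prim_expr_order prw) expr1n normr1.
(* Expanding the conjugate and exchanging the sums makes each u occur once for each of the [d u]
   members t of its class, which cancels the denominator. *)
have sqE : \sum_t (D t)%:R / (d t)%:R * (V t * (V t)^*) = 0.
  rewrite -[RHS]sumC.
  under eq_bigr => t _ do rewrite {2}/V rmorph_sum !mulr_sumr.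
  rewrite (exchange_big_dep xpredT) //=; apply: eq_bigr => u _.
  rewrite (eq_bigl (eqv u)); last by move=> t; rewrite eqvC.
  under eq_bigr => t e.
    rewrite -(VE _ _ e) /D (dE _ _ e); over.
  rewrite sumr_const -wV -/(D u) -[#|_|]/(d u) -[LHS]mulr_natl.
  by rewrite mulrCA [LHS]mulrA divfK // pnatr_eq0 -lt0n.
have V0 t : V t = 0.
  apply/eqP; rewrite -normr_eq0 -sqrf_eq0 normCK.
  have D0 : (D t)%:R / (d t)%:R != 0 :> algC.
    rewrite mulf_neq0 ?invr_eq0 ?pnatr_eq0 -?lt0n //.
    by move: (fact_gt0 n); rewrite -(DE t); case: (D t).
  have := psumr_eq0P _ sqE; move/(_ _ t isT)/eqP.
  rewrite mulf_eq0 (negbTE D0) /=; apply=> u _.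
  by rewrite mulr_ge0 ?divr_ge0 ?ler0n // mul_conjC_ge0.
move=> t.
(* Back from [w] to [z]: the class sum of the [nu u] vanishes, and it is [d t] times [al t]. *)
have := root_intr_prim_transfer chC ch0 prw prz (p := W t).
rewrite !rootE !hW => /(_ _)/eqP S0.
have : (d t)%:R * al t = 0.
  rewrite -avg (eq_bigr (fun u => nu (rep t) * z ^+ k u)) => [|u e].
    by rewrite -mulr_sumr S0 ?mulr0 // [X in X == _]V0.
  by rewrite [LHS]kE (repE t u e).
move/eqP; rewrite mulf_eq0 nat0 => /orP[|/eqP//].
by move: (d0 t); case: (d t).
Qed.

(** * From eigenvalues to commuting matrices *)

Lemma horner_mx_comp_Xn (F : fieldType) (n' : nat) (A : 'M[F]_n'.+1)
    (p : {poly F}) (N : nat) :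
  horner_mx A (p \Po 'X^N) = horner_mx (A ^+ N) p.
Proof.
elim/poly_ind: p => [|p c IHp]; first by rewrite comp_poly0 !rmorph0.
rewrite comp_polyD comp_polyM comp_polyX comp_polyC !rmorphD !rmorphM /= IHp.
by rewrite !horner_mx_C horner_mx_X rmorphXn /= horner_mx_X.
Qed.

(** The derivative is N X^(N-1) p'(X^N). The factor p'(X^N) is coprime to p(X^N) by separability of
    p, and X is because p(0) is nonzero. *)
Lemma separable_comp_Xn (F : fieldType) (p : {poly F}) (N : nat) :
  N%:R != 0 :> F -> separable_poly p -> ~~ root p 0 ->
  separable_poly (p \Po 'X^N).
Proof.
move=> N0 sp p0; rewrite unlock deriv_comp coprimepMr.
have N0' : (0 < N)%N by case: N N0 => //; rewrite eqxx.
rewrite unlock in sp; rewrite (coprimep_comp_poly _ sp) /= derivXn -scaler_nat coprimepZr //.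
apply: coprimep_expr; rewrite coprimepX rootE horner_comp hornerXn.
by rewrite expr0n (gtn_eqF N0') -rootE.
Qed.

Lemma map_mxminpoly_diagonalizable (k L : fieldType) (f : {rmorphism k -> L})
    (n' : nat) (A : 'M[k]_n'.+1) (rs : seq L) :
  separable_poly (mxminpoly A) ->
  map_poly f (mxminpoly A) %| \prod_(x <- rs) ('X - x%:P) ->
  exists2 P : 'M_n'.+1, P \in unitmx & similar_diag P (map_mx f A).
Proof.
rewrite -(separable_map f) => sep /dvdp_prod_XsubC[m Em].
apply/diagonalizableP; exists (mask m rs); last first.
  by rewrite mxminpoly_map (eqp_dvdl _ Em).
by rewrite -separable_prod_XsubC -(eqp_separable Em).
Qed.

(** Over a splitting field [A] and [P] are simultaneously diagonalizable, and their eigenvalues are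
    the [nu] and [al] of [trace_sum_eq0]. For [A] itself, the minimal polynomial divides mu(X^N),
    with mu that of [A ^+ N], and this is separable because [A] is invertible. *)
Lemma mxtrace_mul_inv_eq0 (k : fieldType) (n' N : nat) (A P : 'M[k]_n'.+1) :
  [pchar k] =i pred0 -> (0 < N)%N -> A * P = P * A -> A \is a GRing.unit ->
  separable_poly (mxminpoly P) -> separable_poly (mxminpoly (A ^+ N)) ->
  (forall i j, \tr (A * (P ^+ i * (A ^+ N) ^+ j)) =
               \tr (P * (P ^+ i * (A ^+ N) ^+ j))) ->
  \tr (P * A^-1) = 0 -> P = 0.
Proof.
move=> ch0 N0 AP uA sepP sepA htr tr0.
pose q := mxminpoly (A ^+ N) \Po 'X^N.
have N0k : N%:R != 0 :> k by rewrite ((pcharf0P k).1 ch0) -lt0n.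
have sepq : separable_poly q.
  apply: separable_comp_Xn => //; rewrite -eigenvalue_root_min.
  apply/eigenvalueP => -[v /eqP]; rewrite scale0r => /eqP vA /eqP[].
  have E : A ^+ N *m (A ^+ N)^-1 = 1%:M by apply: mulrV; rewrite unitrX.
  by rewrite -[v]mulmx1 -E mulmxA vA mul0mx.
have minA : mxminpoly A %| q.
  by apply: mxminpoly_min; rewrite horner_mx_comp_Xn mx_root_minpoly.
(* A field splitting this product diagonalizes both matrices and contains a primitive N-th root of
   unity. *)
pose s := mxminpoly P * q * ('X^N - 1).
have s0 : s != 0.
  by rewrite !mulf_neq0 ?separable_poly_neq0 // separable_Xn_sub_1.
have [L [f [rs Ef]]] := splitting_extension s0.
have dvd p : p %| s -> map_poly f p %| \prod_(x <- rs) ('X - x%:P).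
  by move=> ps; rewrite -(eqp_dvdr _ Ef) dvdp_map.
have chL : [pchar L] =i pred0 by move=> p; rewrite (fmorph_pchar f).
have [z prz] : exists z : L, N.-primitive_root z.
  have /dvdp_prod_XsubC[m] := dvd ('X^N - 1) (dvdp_mull _ (dvdpp _)).
  rewrite rmorphB /= map_polyXn rmorph1 => Em.
  have uniqm : uniq (mask m rs).
    rewrite -separable_prod_XsubC -(eqp_separable Em) separable_Xn_sub_1 //.
    by rewrite ((pcharf0P L).1 chL) -lt0n.
  have := cyclic.has_prim_root (rs := mask m rs) N0 _ uniqm.
  have sz : size (mask m rs) = N.
    apply: succn_inj; rewrite -(size_prod_XsubC _ id) -(eqp_size Em).
    by rewrite -[1]/(1%:P) size_XnsubC.
  rewrite sz leqnn => /(_ _ isT) h.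
  suff /h/hasP[z _ prz] : all N.-unity_root (mask m rs) by exists z.
  apply/allP => x xm; rewrite unity_rootE -subr_eq0.
  have : root ('X^N - 1) x by rewrite (eqp_root Em) root_prod_XsubC.
  by rewrite rootE -[1]/(1%:P) !hornerE.
have diagP := map_mxminpoly_diagonalizable sepP (dvd _ (dvdp_mulr _ (dvdp_mulr _ (dvdpp _)))).
have diagA : exists2 Q : 'M_n'.+1, Q \in unitmx & similar_diag Q (map_mx f A).
  apply: (map_mxminpoly_diagonalizable (rs := rs)); last first.
    by apply/dvd/dvdp_mulr/dvdp_mull.
  have /dvdpP[u Eu] := minA.
  by move: sepq; rewrite Eu separable_mul => /and3P[].
have : exists2 Q : 'M_n'.+1, Q \in unitmx &
    all [pred M | similar_diag Q M] [:: map_mx f A; map_mx f P].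
  apply/codiagonalizableP; split=> [M M'|M].
    rewrite !inE => /orP[] /eqP-> /orP[] /eqP-> //; rewrite /comm_mx -!map_mxM //.
      by congr map_mx.
    by congr map_mx; rewrite -[LHS]AP.
  by rewrite !inE => /orP[] /eqP->.
case=> Q uQ /and3P[/similar_diagPex[a /(similarRL uQ) Ea] /similar_diagPex[b /(similarRL uQ) Eb] _].
pose c (M : 'M[k]_n'.+1) : 'M[L]_n'.+1 := Q *m map_mx f M *m invmx Q.
have cM M M' : c (M * M') = c M * c M'.
  rewrite /c -[M * M']/(M *m M') map_mxM -!mulmxE !mulmxA.
  by rewrite -(mulmxA _ (invmx Q)) mulVmx // mulmx1.
have c1 : c 1 = 1 by rewrite /c map_mx1 mulmx1 mulmxV.
have cX M i : c (M ^+ i) = c M ^+ i.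
  by elim: i => [|i IHi]; rewrite ?expr0 // !exprS cM IHi.
have ctr M : \tr (c M) = f (\tr M).
  by rewrite /c mxtrace_mulC mulmxA mulVmx // mul1mx trace_map_mx.
have diagM (u v : 'rV[L]_n'.+1) : diag_mx u * diag_mx v = diag_mx (\row_t (u 0 t * v 0 t)).
  by rewrite -[LHS]/(_ *m _) mulmx_diag; congr diag_mx; apply/rowP=> t; rewrite !mxE.
have diagX (u : 'rV[L]_n'.+1) i : diag_mx u ^+ i = diag_mx (\row_t u 0 t ^+ i).
  elim: i => [|i IHi].
    by rewrite expr0 -[1]/(1%:M) -diag_const_mx; congr diag_mx; apply/rowP=> t; rewrite !mxE expr0.
  by rewrite exprS IHi diagM; congr diag_mx; apply/rowP=> t; rewrite !mxE exprS.
have cA : c A = diag_mx a by [].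
have cP : c P = diag_mx b by [].
have trd (u : 'rV[L]_n'.+1) : \tr (diag_mx u) = \sum_t u 0 t by rewrite mxtrace_diag.
pose a' := \row_t (c A^-1) t t.
have a1 t : a 0 t * (c A^-1) t t = 1.
  have := congr1 c (mulrV uA); rewrite cM c1 cA => /matrixP/(_ t t).
  by rewrite -[_ * _]/(_ *m _) mul_diag_mx !mxE eqxx.
have a0 t : a 0 t != 0.
  by apply/eqP => at0; have := a1 t; rewrite at0 mul0r => /esym/eqP; rewrite oner_eq0.
have b0 := @trace_sum_eq0 L _ N z (b 0) (a 0) chL prz a0.
have {b0} b0 t : b 0 t = 0.
  apply: b0 => [i j|].
    have := congr1 f (htr i j); rewrite -!ctr !(cM, cX) cA cP !diagX !diagM !trd.
    by move=> E; apply: etrans (etrans _ E) _; apply: eq_bigr => u _; rewrite !mxE.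
  have := congr1 f tr0; rewrite -ctr rmorph0 cM cP => E.
  apply: etrans _ E; apply: eq_bigr => u _.
  rewrite -[_ * c _]/(_ *m _) mul_diag_mx mxE.
  by congr (_ * _); apply: (mulfI (a0 u)); rewrite a1 mulfV.
apply: (@map_mx_inj _ _ f); rewrite map_mx0.
have : c P = 0.
  by rewrite cP; apply/matrixP=> i j; rewrite !mxE b0 mul0rn.
rewrite /c => /(congr1 (fun M => invmx Q *m M *m Q)).
by rewrite mulmx0 mul0mx -mulmxA !mulmxA mulmxKV // mulVmx // mul1mx.
Qed.

(** * Contractions and traces *)

Section Contraction.
Variables (k : fieldType) (M N : lmodType k).

Definition mk_scalar (V : lmodType k) (f : V -> k) (hf : scalar f) : {scalar V} :=
  HB.pack f (GRing.isLinear.Build k V k *%R f hf).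

Definition mk_linear (V W : lmodType k) (f : V -> W) (hf : linear f) :
    {linear V -> W} :=
  HB.pack f (GRing.isLinear.Build k V W *:%R f hf).

(** The contractions id ⊗ f and f ⊗ id. On a coproduct they are h_1 f(h_2) and f(h_1) h_2 in
    Sweedler notation. *)
Definition tens_ctr (f : N -> k) (t : tens M N) : M :=
  tens_lift (fun x y => f y *: x) t.
Definition tens_ctl (f : M -> k) (t : tens M N) : N :=
  tens_lift (fun x y => f x *: y) t.

Section Ctr.
Variable f : {scalar N}.

Lemma tens_ctr_bilin : bilin (fun (x : M) (y : N) => f y *: x).
Proof.
split=> [x x' y|x y y'|x a y]; first by rewrite scalerDr.
  by rewrite linearD scalerDl.
by rewrite [f (a *: y)]linearZ /= scalerA mulrC.
Qed.

Lemma tens_ctrE x y : tens_ctr f (x ⊗ y) = f y *: x.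
Proof. exact: tens_lift_otimes tens_ctr_bilin x y. Qed.

Fact tens_ctr_linear : linear (tens_ctr f).
Proof.
move=> a t u; rewrite /tens_ctr (tens_liftD tens_ctr_bilin); congr (_ + _).
elim/tens_ind: t => [|x y t IHt].
  by rewrite scaler0 !(tens_lift0 tens_ctr_bilin) scaler0.
rewrite scalerDr !(tens_liftD tens_ctr_bilin) IHt scalerDr; congr (_ + _).
by rewrite -otimesZl !(tens_lift_otimes tens_ctr_bilin) !scalerA mulrC.
Qed.
HB.instance Definition _ :=
  GRing.isLinear.Build k (tens M N) M *:%R (tens_ctr f) tens_ctr_linear.
End Ctr.

Section Ctl.
Variable f : {scalar M}.

Lemma tens_ctl_bilin : bilin (fun (x : M) (y : N) => f x *: y).
Proof.
split=> [x x' y|x y y'|x a y]; last by rewrite [f (a *: x)]linearZ /= scalerA mulrC.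
  by rewrite linearD scalerDl.
by rewrite scalerDr.
Qed.

Lemma tens_ctlE x y : tens_ctl f (x ⊗ y) = f x *: y.
Proof. exact: tens_lift_otimes tens_ctl_bilin x y. Qed.

Fact tens_ctl_linear : linear (tens_ctl f).
Proof.
move=> a t u; rewrite /tens_ctl (tens_liftD tens_ctl_bilin); congr (_ + _).
elim/tens_ind: t => [|x y t IHt].
  by rewrite scaler0 !(tens_lift0 tens_ctl_bilin) scaler0.
rewrite scalerDr !(tens_liftD tens_ctl_bilin) IHt scalerDr; congr (_ + _).
by rewrite -otimesZl !(tens_lift_otimes tens_ctl_bilin) linearZ /= scalerA.
Qed.
HB.instance Definition _ :=
  GRing.isLinear.Build k (tens M N) N *:%R (tens_ctl f) tens_ctl_linear.
End Ctl.

Lemma otimes0l (y : N) : (0 : M) ⊗ y = 0.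
Proof. by rewrite -(scale0r (0 : M)) otimesZl scale0r. Qed.
Lemma otimes0r (x : M) : x ⊗ (0 : N) = 0.
Proof. by rewrite -(scale0r (0 : N)) otimesZr scale0r. Qed.
Lemma otimes_suml I (s : seq I) (P : pred I) (F : I -> M) (y : N) :
  (\sum_(i <- s | P i) F i) ⊗ y = \sum_(i <- s | P i) F i ⊗ y.
Proof.
by apply: (big_morph (fun x => x ⊗ y) _ (otimes0l y)) => x x'; rewrite otimesDl.
Qed.
Lemma otimes_sumr I (s : seq I) (P : pred I) (x : M) (F : I -> N) :
  x ⊗ (\sum_(i <- s | P i) F i) = \sum_(i <- s | P i) x ⊗ F i.
Proof. by apply: (big_morph _ (otimesDr x) (otimes0r x)). Qed.

End Contraction.

(** * Coordinates and traces in finite dimension *)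

Section FiniteDim.
Variables (k : fieldType) (V : vectType k).
Notation m := (\dim {:V}).
Notation e := (vbasis {:V}).

Lemma vbasis_sum (x : V) : x = \sum_i coord e i x *: e`_i.
Proof. exact: coord_vbasis (memvf x). Qed.

Lemma coord_e (i j : 'I_m) : coord e i e`_j = (i == j)%:R.
Proof. by rewrite coord_free ?(basis_free (vbasisP _)) 1?eq_sym. Qed.

Lemma tens_sumr (M : lmodType k) (t : tens M V) :
  t = \sum_i tens_ctr (coord e i) t ⊗ e`_i.
Proof.
elim/tens_ind: t => [|x y t IHt].
  by rewrite big1 // => i _; rewrite linear0 otimes0l.
rewrite {1}IHt; under [RHS]eq_bigr => i _ do rewrite linearD otimesDl /= tens_ctrE.
rewrite big_split; congr (_ + _).
by rewrite {1}(vbasis_sum y) otimes_sumr; apply: eq_bigr => i _; rewrite otimesZ.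
Qed.

Lemma tens_suml (N : lmodType k) (t : tens V N) :
  t = \sum_(i < m) e`_i ⊗ tens_ctl (coord e i) t.
Proof.
elim/tens_ind: t => [|x y t IHt].
  by rewrite big1 // => i _; rewrite linear0 otimes0r.
rewrite {1}IHt; under [RHS]eq_bigr => i _ do rewrite linearD otimesDr /= tens_ctlE.
rewrite big_split; congr (_ + _).
by rewrite {1}(vbasis_sum x) otimes_suml; apply: eq_bigr => i _; rewrite otimesZ.
Qed.

Lemma tens_ctr_sum (M : lmodType k) (F : 'I_m -> M) (j : 'I_m) :
  tens_ctr (coord e j) (\sum_i F i ⊗ e`_i) = F j.
Proof.
rewrite linear_sum (bigD1 j) //= tens_ctrE /= coord_e eqxx scale1r big1 ?addr0 //.
by move=> i ij; rewrite tens_ctrE /= coord_e eq_sym (negbTE ij) scale0r.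
Qed.

Lemma tens_ctl_sum (N : lmodType k) (F : 'I_m -> N) (j : 'I_m) :
  tens_ctl (coord e j) (\sum_(i < m) e`_i ⊗ F i) = F j.
Proof.
rewrite linear_sum (bigD1 j) //= tens_ctlE /= coord_e eqxx scale1r big1 ?addr0 //.
by move=> i ij; rewrite tens_ctlE /= coord_e eq_sym (negbTE ij) scale0r.
Qed.

Lemma linear_vbasis_ext (W : lmodType k) (F G : V -> W) :
  linear F -> linear G -> (forall i : 'I_m, F e`_i = G e`_i) -> F =1 G.
Proof.
move=> hF hG FG x; pose F' := mk_linear hF; pose G' := mk_linear hG.
rewrite -[F x]/(F' x) -[G x]/(G' x) (vbasis_sum x) !linear_sum.
by apply: eq_bigr => i _; rewrite !linearZ; congr (_ *: _); apply: FG.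
Qed.

(** Trace and matrix take bare functions, so that composites such as h |-> S(S h) y need no bundled
    linear structure; linearity is assumed only where it is used. *)
Definition ftrace (F : V -> V) : k := \sum_i coord e i (F e`_i).
Definition fmx (F : V -> V) : 'M[k]_m := \matrix_(i, j) coord e i (F e`_j).

Lemma eq_ftrace (F G : V -> V) : F =1 G -> ftrace F = ftrace G.
Proof. by move=> FG; apply: eq_bigr => i _; rewrite FG. Qed.

Lemma ftraceE (F : V -> V) : ftrace F = \tr (fmx F).
Proof. by apply: eq_bigr => i _; rewrite mxE. Qed.

Lemma fmx_comp (F G : V -> V) : linear F -> fmx (F \o G) = fmx F *m fmx G.
Proof.
move=> hF; pose F' : {linear V -> V} := mk_linear hF.
apply/matrixP => i j; rewrite !mxE /= {1}(vbasis_sum (G e`_j)).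
rewrite -[F _]/(F' _) !linear_sum; apply: eq_bigr => l _.
by rewrite !mxE !linearZ /= mulrC.
Qed.

Lemma ftraceC (F G : V -> V) :
  linear F -> linear G -> ftrace (F \o G) = ftrace (G \o F).
Proof. by move=> hF hG; rewrite !ftraceE (fmx_comp G hF) (fmx_comp F hG) mxtrace_mulC. Qed.

Lemma fmx_inj (F G : V -> V) : linear F -> linear G -> fmx F = fmx G -> F =1 G.
Proof.
move=> hF hG /matrixP FG; apply: linear_vbasis_ext => // j.
rewrite (vbasis_sum (F _)) (vbasis_sum (G _)); apply: eq_bigr => i _.
by have := FG i j; rewrite !mxE => ->.
Qed.

Lemma fmx_id : fmx id = 1%:M.
Proof. by apply/matrixP => i j; rewrite !mxE coord_e. Qed.

End FiniteDim.

(** In a full-rank factorization A = C R, idempotency forces R C to be the identity of size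
    [\rank A]. *)
Lemma mxtrace_idem (F : fieldType) n (A : 'M[F]_n) :
  A *m A = A -> \tr A = (\rank A)%:R.
Proof.
move=> AA; rewrite -{1}(mulmx_base A) mxtrace_mulC.
suff -> : row_base A *m col_base A = 1%:M by rewrite mxtrace1.
apply: (row_full_inj (col_base_full A)); apply: (row_free_inj (row_base_free A)).
by rewrite /= mulmx1 (mulmxA (col_base A)) mulmx_base -(mulmxA A) mulmx_base.
Qed.

(** A left inverse equals a right inverse, for matrices over a noncommutative and possibly zero
    ring. With entries in H or H ⊗ H this replaces uniqueness of convolution inverses. *)
Lemma inverse_matrix_unique (I : finType) (R : pzRingType) (U V W : I -> I -> R) :
  (forall i j, \sum_l U i l * V l j = (i == j)%:R) ->
  (forall i j, \sum_l V i l * W l j = (i == j)%:R) ->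
  forall i j, U i j = W i j.
Proof.
move=> UV VW i j.
transitivity (\sum_p \sum_l U i p * V p l * W l j).
  under eq_bigr => p _.
    under eq_bigr => l _ do rewrite -mulrA.
    rewrite -mulr_sumr VW; over.
  rewrite (bigD1 j) //= eqxx mulr1 big1 ?addr0 // => p /negbTE->.
  by rewrite mulr0.
rewrite exchange_big /= (bigD1 i) //= -mulr_suml UV eqxx mul1r big1 ?addr0 // => l.
by rewrite eq_sym -mulr_suml UV => /negbTE->; rewrite mul0r.
Qed.

(** * Antipode and integrals *)

Section TensMaps.
Variable k : fieldType.

Section TensMap.
Variables (M M' N N' : lmodType k).
Variables (f : {linear M -> M'}) (g : {linear N -> N'}).

Lemma tens_map_bilin : bilin (fun x y => f x ⊗ g y).
Proof.
split=> [u u' v|u v v'|u a v].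
- by rewrite linearD otimesDl.
- by rewrite linearD otimesDr.
- by rewrite !linearZ /= otimesZ.
Qed.

Lemma tens_mapD : {morph tens_map f g : u v / u + v}.
Proof. by move=> u v; apply: (tens_liftD tens_map_bilin). Qed.

Lemma tens_map0 : tens_map f g 0 = 0.
Proof. exact: (tens_lift0 tens_map_bilin). Qed.

Lemma tens_map_sum I (s : seq I) (x : I -> M) (y : I -> N) :
  tens_map f g (\sum_(i <- s) x i ⊗ y i) = \sum_(i <- s) f (x i) ⊗ g (y i).
Proof.
rewrite (big_morph _ tens_mapD tens_map0).
by apply: eq_bigr => i _; rewrite tens_map_otimes.
Qed.

End TensMap.

Lemma tens_assoc_sum (M N P : lmodType k) I (s : seq I) (x : I -> tens M N) (y : I -> P) :
  tens_assoc (\sum_(i <- s) x i ⊗ y i) = \sum_(i <- s) tens_assoc (x i ⊗ y i).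
Proof.
have bil (v : P) : bilin (fun (x : M) (y : N) => x ⊗ (y ⊗ v)).
  split=> [u u' w|u w w'|u a w]; first exact: otimesDl.
    by rewrite !otimesDl otimesDr.
  by rewrite otimesZ otimesZl.
suff bil2 : bilin (fun (t : tens M N) (z : P) =>
    tens_lift (fun x y => x ⊗ (y ⊗ z)) t).
  by rewrite /tens_assoc (big_morph _ (tens_liftD bil2) (tens_lift0 bil2)).
split=> [t t' v|t v v'|t a v]; first by rewrite tens_liftD.
- elim/tens_ind: t => [|u w t IHt]; first by rewrite !tens_lift0 ?addr0.
  by rewrite !tens_liftD // IHt !tens_lift_otimes // !otimesDr addrACA.
- elim/tens_ind: t => [|u w t IHt]; first by rewrite scaler0 !tens_lift0.
  rewrite scalerDr !tens_liftD // IHt -otimesZl !tens_lift_otimes //.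
  by rewrite otimesZ -otimesZl otimesZ.
Qed.

End TensMaps.

(** * Antipode identities by matrix inversion *)

Section Hopf.
Variables (k : fieldType) (H : hopfAlgebra k).
Notation m := (\dim {:H}).
Notation e := (vbasis {:H}).
Notation Delta := (@comul k H).
Notation eps := (@counit k H).
Notation S := (@antipode k H).

(* The coordinate matrix of the comultiplication in a basis e of H:
   Delta (e j) = sum_i e i ⊗ t i j.  It satisfies Delta t = t ⊗ t and S t = t^-1,
   which turns computations with iterated comultiplications into products of
   matrices over H. *)
Definition comul_mx (i j : 'I_m) : H := tens_ctl (coord e i) (Delta e`_j).
Notation t := comul_mx.

Lemma comul_e (j : 'I_m) : Delta e`_j = \sum_(i < m) e`_i ⊗ t i j.
Proof. exact: tens_suml. Qed.

Lemma comul_comul_mx (i j : 'I_m) : Delta (t i j) = \sum_l t i l ⊗ t l j.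
Proof.
have := comulA (e`_j : H); rewrite comul_e (tens_map_sum Delta idfun) (tens_map_sum idfun Delta) tens_assoc_sum.
under eq_bigr => l _ do rewrite /= comul_e otimes_suml.
move=> /(congr1 (tens_ctl (coord e i))).
rewrite (tens_ctl_sum (fun l => Delta (t l j))) => <-.
under eq_bigr => l _.
  rewrite tens_assoc_sum.
  under eq_bigr => p _ do rewrite tens_assoc_otimes.
  over.
rewrite exchange_big /=.
under eq_bigr => p _ do rewrite -otimes_sumr.
by rewrite (tens_ctl_sum (fun p => \sum_l t p l ⊗ t l j)).
Qed.

Lemma counit_comul_mx (i j : 'I_m) : eps (t i j) = (i == j)%:R.
Proof.
have := comul_counitr (e`_j : H); rewrite -[LHS]/(tens_ctr eps _) comul_e linear_sum.
under eq_bigr => l _ do rewrite /= tens_ctrE.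
move=> /(congr1 (coord e i)); rewrite coord_e linear_sum => <-.
rewrite (bigD1 i) //= linearZ /= coord_e eqxx mulr1 big1 ?addr0 // => l /negbTE li.
by rewrite linearZ /= coord_e eq_sym li mulr0.
Qed.

Lemma e_comul_mx (j : 'I_m) : e`_j = \sum_(i < m) eps e`_i *: t i j.
Proof.
have := comul_counitl (e`_j : H); rewrite -[LHS]/(tens_ctl eps _) comul_e linear_sum.
by move=> <-; apply: eq_bigr => l _; rewrite /= tens_ctlE.
Qed.

(** The entries [t i j] span H by the counit axiom, so a linear identity needs checking only on
    them, where comultiplication and antipode are matrix product and inverse. *)
Lemma linear_comul_mx_ext (W : lmodType k) (F G : H -> W) :
  linear F -> linear G -> (forall i j, F (t i j) = G (t i j)) -> F =1 G.
Proof.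
move=> hF hG FG; apply: linear_vbasis_ext => // j.
rewrite -[F _]/(mk_linear hF _) -[G _]/(mk_linear hG _) e_comul_mx !linear_sum.
by apply: eq_bigr => i _; rewrite !linearZ; congr (_ *: _); apply: FG.
Qed.

Lemma antipode_mull (i j : 'I_m) : \sum_l S (t i l) * t l j = (i == j)%:R.
Proof.
have bil : bilin (fun x y : H => S x * y).
  split=> [x x' y|x y y'|x a y]; first by rewrite linearD mulrDl.
    by rewrite mulrDr.
  by rewrite linearZ /= -scalerAl scalerAr.
have := comul_antipodel (t i j); rewrite comul_comul_mx counit_comul_mx scaler_nat => <-.
rewrite (big_morph _ (tens_liftD bil) (tens_lift0 bil)).
by apply: eq_bigr => l _; rewrite (tens_lift_otimes bil).
Qed.

Lemma antipode_mulr (i j : 'I_m) : \sum_l t i l * S (t l j) = (i == j)%:R.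
Proof.
have bil : bilin (fun x y : H => x * S y).
  split=> [x x' y|x y y'|x a y]; first by rewrite mulrDl.
    by rewrite linearD mulrDr.
  by rewrite linearZ /= -scalerAl scalerAr.
have := comul_antipoder (t i j); rewrite comul_comul_mx counit_comul_mx scaler_nat => <-.
rewrite (big_morph _ (tens_liftD bil) (tens_lift0 bil)).
by apply: eq_bigr => l _; rewrite (tens_lift_otimes bil).
Qed.

Lemma antipode1 : S 1 = 1.
Proof.
have bil : bilin (fun x y : H => S x * y).
  split=> [x x' y|x y y'|x a y]; first by rewrite linearD mulrDl.
    by rewrite mulrDr.
  by rewrite linearZ /= -scalerAl scalerAr.
have := comul_antipodel (1 : H); rewrite !rmorph1 scale1r.
by rewrite -otimes1 (tens_lift_otimes bil) mulr1.
Qed.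

Lemma counit_antipode x : eps (S x) = eps x.
Proof.
move: x; apply: (linear_comul_mx_ext (W := k^o)) => [a x y|a x y|i j].
- by rewrite !linearP.
- by rewrite linearP.
rewrite counit_comul_mx.
have := congr1 eps (antipode_mull i j).
rewrite rmorph_nat rmorph_sum (bigD1 j) //= rmorphM /= counit_comul_mx eqxx mulr1 => <-.
rewrite big1 ?addr0 // => l /negbTE lj.
by rewrite rmorphM /= counit_comul_mx lj mulr0.
Qed.

(** On products of entries, indexed by pairs, both sides invert the matrix of the t_ij t_pq: S(t_ij
    t_pq) from the left and S(t_pq) S(t_ij) from the right. *)
Lemma antipodeM x y : S (x * y) = S y * S x.
Proof.
have h i j p q : S (t i j * t p q) = S (t p q) * S (t i j).
  pose U (a b : 'I_m * 'I_m) := S (t a.1 b.1 * t a.2 b.2).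
  pose V (a b : 'I_m * 'I_m) := t a.1 b.1 * t a.2 b.2.
  pose W (a b : 'I_m * 'I_m) := S (t a.2 b.2) * S (t a.1 b.1).
  have bil : bilin (fun x y : H => S x * y).
    split=> [u u' v|u v v'|u a v]; first by rewrite linearD mulrDl.
      by rewrite mulrDr.
    by rewrite linearZ /= -scalerAl scalerAr.
  apply: (@inverse_matrix_unique _ _ U V W _ _ (i, p) (j, q)) => -[a b] [c d].
    have := comul_antipodel (t a c * t b d).
    rewrite !rmorphM /= !comul_comul_mx !counit_comul_mx big_distrlr /=.
    rewrite pair_big /=.
    under eq_bigr => l _ do rewrite otimesM.
    rewrite (big_morph _ (tens_liftD bil) (tens_lift0 bil)).
    under eq_bigr => l _ do rewrite (tens_lift_otimes bil).
    move=> ->; rewrite -natrM mulnb -[(_, _) == _]/((_ == _) && (_ == _)) /=.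
    by rewrite scaler_nat.
  rewrite -(pair_big xpredT xpredT (fun l l' => V (a, b) (l, l') * W (l, l') (c, d))) /=.
  transitivity (\sum_l (t a l * (\sum_l' t b l' * S (t l' d)) * S (t l c))).
    apply: eq_bigr => l _; rewrite mulr_sumr mulr_suml.
    by apply: eq_bigr => l' _; rewrite /V /W /= !mulrA.
  rewrite antipode_mulr -[(_, _) == _]/((_ == _) && (_ == _)) /=.
  have [bd|bd] := eqVneq b d; last first.
    by rewrite andbF big1 // => l _; rewrite mulr0 mul0r.
  by under eq_bigr => l _ do rewrite mulr1; rewrite antipode_mulr andbT.
move: x; apply: linear_comul_mx_ext => [a x x'|a x x'|i j].
- by rewrite mulrDl -scalerAl linearP.
- by rewrite linearP mulrDr -scalerAr.
move: y; apply: linear_comul_mx_ext => [a y y'|a y y'|p q] //.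
- by rewrite mulrDr -scalerAr linearP.
- by rewrite linearP mulrDl -scalerAl.
Qed.

(** Again two one-sided inverses of one matrix, that of the [Delta (t i j)] over H ⊗ H. *)
Lemma comul_antipode_mx (i j : 'I_m) :
  Delta (S (t i j)) = \sum_l S (t l j) ⊗ S (t i l).
Proof.
apply: (@inverse_matrix_unique _ (tens H H) (fun i j => Delta (S (t i j)))
  (fun i j => Delta (t i j)) (fun i j => \sum_l S (t l j) ⊗ S (t i l))) => a b.
  under eq_bigr => l _ do rewrite -rmorphM.
  by rewrite -rmorph_sum antipode_mull rmorph_nat.
under eq_bigr => l _ do rewrite comul_comul_mx big_distrlr /=.
transitivity (\sum_p \sum_q (t a p * S (t q b)) ⊗ (\sum_l t p l * S (t l q))).
  rewrite exchange_big; apply: eq_bigr => p _ /=.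
  rewrite exchange_big; apply: eq_bigr => q _ /=.
  by rewrite otimes_sumr; apply: eq_bigr => l _; rewrite otimesM.
under eq_bigr => p _.
  rewrite (bigD1 p) //= antipode_mulr eqxx big1 ?addr0; last first.
    by move=> q; rewrite eq_sym antipode_mulr => /negbTE->; rewrite otimes0r.
  over.
rewrite -otimes_suml antipode_mulr; case: (a == b); rewrite ?otimes1 //.
exact: otimes0l.
Qed.

End Hopf.

(** Decompose 1 = u + v along I and a complement J: for x in I, x - x u = x v lies in both I and
    J. *)
Lemma semisimple_left_ideal_unit (k : fieldType) (A : falgType k) (I : {vspace A}) :
  semisimple A -> (fullv * I <= I)%VS ->
  exists2 u, u \in I & forall x, x \in I -> x = x * u.
Proof.
move=> ss hI; have [J [hJ IJ IJ0]] := ss I hI.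
have /memv_addP[u uI [v vJ uv]] : (1 : A) \in (I + J)%VS by rewrite IJ memvf.
exists u => // x xI; apply/eqP; rewrite -subr_eq0 -memv0 -IJ0 memv_cap; apply/andP; split.
  apply: rpredB => //; apply: (subvP hI); exact: memv_mul (memvf x) uI.
have -> : x - x * u = x * v by rewrite -{1}[x]mulr1 uv mulrDr addrAC subrr add0r.
by apply: (subvP hJ); apply: memv_mul (memvf x) vJ.
Qed.

Lemma left_idealP (k : fieldType) (A : falgType k) (I : {vspace A}) :
  (forall x y, y \in I -> x * y \in I) -> (fullv * I <= I)%VS.
Proof. by move=> h; apply/prodvP => x y _; apply: h. Qed.

(** * Integrals, and the fourth power of the antipode *)

Section Integral.
Variables (k : fieldType) (H : hopfAlgebra k).
Notation m := (\dim {:H}).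
Notation e := (vbasis {:H}).
Notation Delta := (@comul k H).
Notation eps := (@counit k H).
Notation S := (@antipode k H).
Notation t := (@comul_mx k H).

Lemma semisimple_integral : semisimple H ->
  exists L : H, [/\ forall h, h * L = eps h *: L, forall h, L * h = eps h *: L &
    eps L = 1].
Proof.
move=> ss; pose I : {vspace H} := lker (linfun (eps : H -> k^o)).
have inI x : (x \in I) = (eps x == 0) by rewrite memv_ker lfunE.
have [|u uI hu] := @semisimple_left_ideal_unit k H I ss.
  by apply: left_idealP => x y; rewrite !inI rmorphM /= => /eqP->; rewrite mulr0.
(* Since [u] is a right unit of the augmentation ideal ker eps, [L] is killed from the left by ker
   eps. *)
pose L : H := 1 - u.
have eL : eps L = 1.
  by move: uI; rewrite inI /L rmorphB rmorph1 /= => /eqP->; rewrite subr0.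
have hL (h : H) : h * L = eps h *: L.
  have : (h - (eps h)%:A) * L = 0.
    rewrite mulrBr mulr1 -hu ?subrr // inI rmorphB /= linearZ /= rmorph1 mulr1.
    by rewrite subrr.
  by rewrite mulrBl -scalerAl mul1r => /eqP; rewrite subr_eq0 => /eqP.
clearbody L; exists L; split=> // h; apply/eqP; rewrite -subr_eq0; apply/eqP.
(* The defect [y] of the right integral property spans a left ideal. A right unit c y of it gives y
   = c y y = c eps(y) y = 0. *)
pose y : H := L * h - eps h *: L.
have hy (x : H) : x * y = eps x *: y.
  by rewrite /y mulrBr mulrA hL -scalerAr (hL x) -scalerAl scalerBr !scalerA [eps h * _]mulrC.
have ey : eps y = 0 by rewrite /y rmorphB rmorphM /= linearZ /= eL mul1r mulr1 subrr.
have [|u' /vlineP[c ->] hu'] := @semisimple_left_ideal_unit k H <[y]>%VS ss.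
  apply: left_idealP => x z /vlineP[c ->].
  by rewrite -scalerAr hy !rpredZ // memv_line.
by rewrite -/y (hu' y (memv_line y)) -scalerAr hy ey scale0r scaler0.
Qed.

Lemma antipodeK2_linear : linear (S \o S).
Proof. by move=> a x y /=; rewrite !linearP. Qed.

Definition lam (y : H) : k := ftrace (fun h => S (S h) * y).

Fact lam_scalar : scalar lam.
Proof.
move=> a x y; rewrite /lam /ftrace mulr_sumr -big_split; apply: eq_bigr => i _ /=.
by rewrite mulrDr -scalerAr linearP.
Qed.
HB.instance Definition _ := GRing.isLinear.Build k H k *%R lam lam_scalar.

(** Split off right multiplication by [w] and rotate the trace: S^2(h w) y = S^2(h) S^2(w) y. So S^2
    is the Nakayama automorphism of [lam]. *)
Lemma lam_nakayama (y w : H) : lam (y * w) = lam (S (S w) * y).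
Proof.
rewrite /lam; pose F h := S (S h) * y; pose G h : H := h * w.
have hF : linear F by move=> a p q; rewrite /F !linearP mulrDl scalerAl.
have hG : linear G by move=> a p q; rewrite /G mulrDl scalerAl.
transitivity (ftrace (G \o F)); first by apply: eq_ftrace => h /=; rewrite /G /F mulrA.
rewrite (ftraceC hG hF); apply: eq_ftrace => h /=.
by rewrite /G /F !antipodeM mulrA.
Qed.

Section TwoSided.
Variable L : H.
Hypothesis mulL : forall h, h * L = eps h *: L.
Hypothesis Lmul : forall h, L * h = eps h *: L.
Hypothesis epsL : eps L = 1.

Notation a := (fun s : 'I_m => tens_ctr (coord e s) (Delta L)).

Lemma comul_integral : Delta L = \sum_s a s ⊗ e`_s.
Proof. exact: tens_sumr. Qed.

(** Insert S(x_1) x_2 ⊗ x_3 for 1 ⊗ x and absorb x_2 ⊗ x_3 by Delta(h L) = eps(h) Delta(L). *)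
Lemma otimes_mul_comul_integral (x : H) : (1 ⊗ x) * Delta L = (S x ⊗ 1) * Delta L.
Proof.
move: x; apply: linear_comul_mx_ext => [c x y|c x y|i j].
- by rewrite otimesDr otimesZr mulrDl tens_scalerAl.
- by rewrite linearP otimesDl otimesZl mulrDl tens_scalerAl.
transitivity (\sum_l \sum_p ((S (t i l) * t l p) ⊗ t p j) * Delta L).
  rewrite exchange_big /= (bigD1 i) //= [X in _ + X]big1 ?addr0 => [|p /negbTE ip].
    by rewrite -mulr_suml -otimes_suml antipode_mull eqxx.
  by rewrite -mulr_suml -otimes_suml antipode_mull eq_sym ip otimes0l mul0r.
transitivity (\sum_l (S (t i l) ⊗ 1) * (Delta (t l j) * Delta L)).
  apply: eq_bigr => l _; rewrite mulrA comul_comul_mx mulr_sumr mulr_suml.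
  by apply: eq_bigr => p _; rewrite otimesM mul1r.
under eq_bigr => l _ do
  rewrite -rmorphM /= mulL linearZ /= counit_comul_mx scaler_nat -mulr_natr mulrA.
rewrite (bigD1 j) //= eqxx mulr1 big1 ?addr0 // => l /negbTE->.
by rewrite mulr0.
Qed.

(** Expand the trace defining [lam] over the basis and move S(S e_i) across Delta L as S e_i: what
    remains is S(L_1) L_2 = eps(L). *)
Lemma sum_lam_integral : \sum_s lam (a s) *: e`_s = 1 :> H.
Proof.
have bil : bilin (fun x y : H => S x * y).
  split=> [x x' y|x y y'|b x y]; first by rewrite linearD mulrDl.
    by rewrite mulrDr.
  by rewrite linearZ /= -scalerAl scalerAr.
have := comul_antipodel L; rewrite epsL scale1r {1}comul_integral.
rewrite (big_morph _ (tens_liftD bil) (tens_lift0 bil)) => E.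
apply: etrans _ E; under [RHS]eq_bigr => s _ do rewrite (tens_lift_otimes bil).
transitivity (\sum_i tens_ctl (coord e i) ((S (S e`_i) ⊗ 1) * Delta L)).
  under [RHS]eq_bigr => i _ do rewrite comul_integral mulr_sumr linear_sum.
  rewrite exchange_big; apply: eq_bigr => s _ /=.
  by rewrite scaler_suml; apply: eq_bigr => i _; rewrite otimesM tens_ctlE mul1r.
under [LHS]eq_bigr => i _ do rewrite -otimes_mul_comul_integral comul_integral mulr_sumr linear_sum.
rewrite exchange_big; apply: eq_bigr => s _ /=.
rewrite {2}(vbasis_sum (a s)) linear_sum mulr_suml; apply: eq_bigr => i _.
by rewrite otimesM tens_ctlE mul1r linearZ -scalerAl.
Qed.

(** From lam(S(x) L_1) L_2 = lam(L_1) x L_2 = x. Thus [a] is dual to the basis for the form lam(S(x)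
    y), which yields bijectivity of S and nondegeneracy of [lam]. *)
Lemma lam_antipode_coord s (x : H) : lam (S x * a s) = coord e s x.
Proof.
have : \sum_s lam (S x * a s) *: e`_s = x.
  transitivity (tens_ctl lam ((S x ⊗ 1) * Delta L)).
    rewrite [in RHS]comul_integral mulr_sumr linear_sum; apply: eq_bigr => i _ /=.
    by rewrite otimesM tens_ctlE mul1r.
  rewrite -otimes_mul_comul_integral comul_integral mulr_sumr linear_sum.
  rewrite -[RHS]mulr1 -[X in _ = _ * X]sum_lam_integral mulr_sumr; apply: eq_bigr => i _ /=.
  by rewrite otimesM tens_ctlE mul1r scalerAr.
move/(congr1 (coord e s)); rewrite linear_sum /= => <-.
rewrite (bigD1 s) //= linearZ /= coord_e eqxx mulr1 big1 ?addr0 // => i /negbTE si.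
by rewrite linearZ /= coord_e eq_sym si mulr0.
Qed.

Lemma antipode_eq0 x : S x = 0 -> x = 0.
Proof.
move=> Sx; rewrite (vbasis_sum x) big1 // => i _.
by rewrite -lam_antipode_coord Sx mul0r linear0 scale0r.
Qed.

Lemma antipode_inj : injective S.
Proof.
move=> x y E; apply/eqP; rewrite -subr_eq0; apply/eqP/antipode_eq0.
by rewrite linearB /= E subrr.
Qed.

Lemma antipode_surj y : exists x, S x = y.
Proof.
have k0 : lker (linfun S) == 0%VS.
  by apply/lker0P => x x'; rewrite !lfunE; apply: antipode_inj.
exists ((linfun S)^-1%VF y).
have /lfunP/(_ y) := lker0_compfV k0.
by rewrite comp_lfunE id_lfunE lfunE.
Qed.

Lemma lam_nondegl u : (forall z, lam (u * z) = 0) -> u = 0.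
Proof.
have [x <-] := antipode_surj u => hx.
suff -> : x = 0 by rewrite linear0.
by rewrite (vbasis_sum x) big1 // => i _; rewrite -lam_antipode_coord hx scale0r.
Qed.

Lemma lam_nondegr u : (forall z, lam (z * u) = 0) -> u = 0.
Proof.
move=> hu; apply/antipode_eq0/antipode_eq0/lam_nondegl => z.
by rewrite -lam_nakayama.
Qed.

Lemma functional_lam (f : {scalar H}) : exists w, forall h, f h = lam (h * w).
Proof.
exists (\sum_(s < m) f (S e`_s) *: a s) => h; have [x <-] := antipode_surj h.
rewrite {1}(vbasis_sum x) !linear_sum mulr_sumr linear_sum; apply: eq_bigr => s _ /=.
by rewrite !linearZ /= -scalerAr linearZ /= lam_antipode_coord mulrC.
Qed.

Lemma integral_sum x : x = \sum_(s < m) lam (S e`_s * x) *: a s.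
Proof.
apply/eqP; rewrite -subr_eq0; apply/eqP; apply: lam_nondegr => z.
have [y <-] := antipode_surj z.
suff h (F : {scalar H}) : (forall s : 'I_m, F e`_s = 0) -> F y = 0.
  pose f u := lam (S u * (x - \sum_(s < m) lam (S e`_s * x) *: a s)).
  have hf : scalar f by move=> c u u'; rewrite /f linearP mulrDl -scalerAl linearP.
  apply: (h (mk_scalar hf)) => s; rewrite -[mk_scalar hf _]/(f _) /f mulrBr linearB /=.
  rewrite mulr_sumr linear_sum (bigD1 s) //= -scalerAr linearZ /= lam_antipode_coord.
  rewrite coord_e eqxx mulr1 big1 ?addr0 ?subrr // => i /negbTE si.
  by rewrite -scalerAr linearZ /= lam_antipode_coord coord_e si mulr0.
by move=> h; rewrite (vbasis_sum y) linear_sum big1 // => i _; rewrite linearZ /= h mulr0.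
Qed.

Lemma linear_integral_ext (W : lmodType k) (F G : H -> W) :
  linear F -> linear G -> (forall s, F (a s) = G (a s)) -> F =1 G.
Proof.
move=> hF hG FG x; rewrite -[F _]/(mk_linear hF _) -[G _]/(mk_linear hG _).
rewrite (integral_sum x) !linear_sum; apply: eq_bigr => s _.
by rewrite !linearZ; congr (_ *: _); apply: FG.
Qed.

Lemma antipode_integral : S L = L.
Proof.
have hSL h : h * S L = eps h *: S L.
  have [x <-] := antipode_surj h.
  by rewrite -antipodeM Lmul linearZ /= counit_antipode.
by have := hSL L; rewrite Lmul counit_antipode epsL !scale1r.
Qed.


Lemma tens_ctl_assoc (f : {scalar H}) (u : tens H H) (z : H) :
  tens_ctl f (tens_assoc (u ⊗ z)) = tens_ctl f u ⊗ z.
Proof.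
rewrite (tens_sumr u) otimes_suml tens_assoc_sum !linear_sum otimes_suml.
by apply: eq_bigr => i _; rewrite tens_assoc_otimes /= !tens_ctlE otimesZl.
Qed.

(** It suffices to treat the spanning [a s]. By coassociativity lam(L_1) L_2 ⊗ L_3 = Delta(lam(L_1)
    L_2) = 1 ⊗ 1 = lam(L_1) 1 ⊗ L_2; compare coefficients of e_s. *)
Lemma lam_invariant y : tens_ctl lam (Delta y) = lam y *: 1.
Proof.
move: y; apply: linear_integral_ext => [c x y|c x y|s].
- by rewrite !linearP.
- by rewrite linearP scalerDl scalerA.
suff E : \sum_s tens_ctl lam (Delta (a s)) ⊗ e`_s = \sum_s (lam (a s) *: 1) ⊗ e`_s.
  have := congr1 (tens_ctr (coord e s)) E.
  by rewrite (tens_ctr_sum (fun s => tens_ctl lam (Delta (a s))))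
             (tens_ctr_sum (fun s => lam (a s) *: 1)).
transitivity (tens_ctl lam (tens_assoc (tens_map Delta id (Delta L)))).
  rewrite [X in tens_map _ _ X]comul_integral (tens_map_sum Delta idfun) tens_assoc_sum.
  by rewrite linear_sum; apply: eq_bigr => i _; rewrite [RHS]tens_ctl_assoc.
rewrite comulA [X in tens_map _ _ X]comul_integral (tens_map_sum idfun Delta) linear_sum.
transitivity (Delta (\sum_i lam (a i) *: e`_i)).
  by rewrite [RHS]linear_sum; apply: eq_bigr => i _; rewrite [LHS]tens_ctlE linearZ.
rewrite sum_lam_integral rmorph1 -otimes1 -[X in _ ⊗ X]sum_lam_integral otimes_sumr.
by apply: eq_bigr => i _; rewrite otimesZ.
Qed.

Lemma lam_integral : lam L = 1.
Proof.
have := lam_invariant L; rewrite comul_integral linear_sum /=.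
under eq_bigr => i _ do rewrite tens_ctlE.
rewrite /= sum_lam_integral -[LHS]scale1r => /eqP.
rewrite -subr_eq0 -scalerBl scaler_eq0 oner_eq0 orbF subr_eq0 => /eqP.
by move->.
Qed.

(** Reading nu(L_1) L_2 = nu(L) 1 at e_s gives nu(a s) = nu(L) coord_s(1), and coord_s(1) = lam(a
    s). *)
Lemma lam_unique (nu : {scalar H}) :
  (forall y, tens_ctl nu (Delta y) = nu y *: 1) -> forall y, nu y = nu L * lam y.
Proof.
move=> hnu; apply: (linear_integral_ext (W := k^o)) => [c x y|c x y|s].
- by rewrite linearP.
- by rewrite linearP /= mulrDr [RHS]addrC addrC; congr (_ + _); rewrite mulrCA.
have := hnu L; rewrite [in X in X = _]comul_integral linear_sum /=.
under eq_bigr => i _ do rewrite tens_ctlE /=.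
move=> /(congr1 (coord e s)); rewrite linear_sum (bigD1 s) //= linearZ /= coord_e eqxx.
rewrite mulr1 big1 ?addr0 => [->|i /negbTE si]; last first.
  by rewrite linearZ /= coord_e eq_sym si mulr0.
rewrite linearZ /=; congr (_ * _).
by rewrite -lam_antipode_coord antipode1 mul1r.
Qed.

(* The distinguished group-like element: h_1 lam(h_2) = lam(h) g. *)
Definition dist_grouplike : H := tens_ctr lam (Delta L).
Notation g := dist_grouplike.

Lemma tens_ctr_comul_mx (f : {scalar H}) i j :
  tens_ctr f (Delta (t i j)) = \sum_l f (t l j) *: t i l.
Proof.
by rewrite comul_comul_mx linear_sum; apply: eq_bigr => l _ /=; rewrite tens_ctrE.
Qed.

Lemma tens_ctl_comul_mx (f : {scalar H}) i j :
  tens_ctl f (Delta (t i j)) = \sum_l f (t i l) *: t l j.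
Proof.
by rewrite comul_comul_mx linear_sum; apply: eq_bigr => l _ /=; rewrite tens_ctlE.
Qed.

(** Each coordinate of h_1 lam(h_2) is an invariant functional of h, hence a multiple of [lam]; its
    value at L is the coordinate of [g]. *)
Lemma lam_dist h : tens_ctr lam (Delta h) = lam h *: g.
Proof.
rewrite (vbasis_sum (tens_ctr _ _)) (vbasis_sum (lam h *: g)).
apply: eq_bigr => i _; congr (_ *: _).
pose f x := coord e i (tens_ctr lam (Delta x)).
have hf : scalar f by move=> c x y; rewrite /f !linearP.
have fE x : mk_scalar hf x = f x by [].
rewrite -[LHS]/(mk_scalar hf h) lam_unique; first by rewrite fE linearZ mulrC.
move: h => _; apply: linear_comul_mx_ext => [c x y|c x y|p q].
- by rewrite !linearP.
- by rewrite linearP scalerDl scalerA.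
rewrite tens_ctl_comul_mx.
transitivity (\sum_l \sum_r (lam (t r l) * coord e i (t p r)) *: t l q).
  apply: eq_bigr => l _; rewrite fE /f tens_ctr_comul_mx (linear_sum (coord e i)) scaler_suml.
  by apply: eq_bigr => r _; rewrite linearZ.
rewrite exchange_big /=.
transitivity (\sum_r coord e i (t p r) *: (lam (t r q) *: (1 : H))).
  apply: eq_bigr => r _; rewrite -lam_invariant tens_ctl_comul_mx scaler_sumr.
  by apply: eq_bigr => l _; rewrite scalerA mulrC.
rewrite ?fE /f tens_ctr_comul_mx (linear_sum (coord e i)) scaler_suml.
by apply: eq_bigr => r _; rewrite [in RHS]linearZ /= scalerA mulrC.
Qed.

Lemma comul_dist : Delta g = g ⊗ g.
Proof.
(* The factor [lam x] makes the claim linear in x, so that it can be tested on the entries of t. *)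
suff h x : lam x *: Delta g = lam x *: (g ⊗ g).
  by have := h L; rewrite lam_integral !scale1r.
move: x; apply: linear_comul_mx_ext => [c x y|c x y|i j].
- by rewrite linearP scalerDl scalerA.
- by rewrite linearP scalerDl scalerA.
rewrite -linearZ -lam_dist tens_ctr_comul_mx linear_sum -otimesZl -lam_dist.
rewrite tens_ctr_comul_mx otimes_suml.
transitivity (\sum_l \sum_p t i p ⊗ (lam (t l j) *: t p l)).
  apply: eq_bigr => l _; rewrite linearZ_LR /= comul_comul_mx scaler_sumr.
  by apply: eq_bigr => p _; rewrite otimesZr.
rewrite exchange_big; apply: eq_bigr => p _ /=.
by rewrite -otimes_sumr -tens_ctr_comul_mx lam_dist otimesZ.
Qed.

Lemma counit_dist : eps g = 1.
Proof.
have h x : eps (tens_ctr lam (Delta x)) = lam x.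
  move: x; apply: (linear_comul_mx_ext (W := k^o)) => [c x y|c x y|i j].
  - by rewrite !linearP.
  - by rewrite linearP.
  rewrite tens_ctr_comul_mx linear_sum (bigD1 i) //= linearZ /= counit_comul_mx.
  rewrite eqxx mulr1 big1 ?addr0 // => l.
  by rewrite linearZ /= counit_comul_mx eq_sym => /negbTE->; rewrite mulr0.
by have := h L; rewrite lam_integral.
Qed.

Lemma antipode_distl : S g * g = 1.
Proof.
have bil : bilin (fun x y : H => S x * y).
  split=> [x x' y|x y y'|x c y]; first by rewrite linearD mulrDl.
    by rewrite mulrDr.
  by rewrite linearZ /= -scalerAl scalerAr.
by have := comul_antipodel g; rewrite comul_dist (tens_lift_otimes bil) counit_dist scale1r.
Qed.

Lemma antipode_distr : g * S g = 1.
Proof.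
have bil : bilin (fun x y : H => x * S y).
  split=> [x x' y|x y y'|x c y]; first by rewrite mulrDl.
    by rewrite linearD mulrDr.
  by rewrite linearZ /= -scalerAl scalerAr.
by have := comul_antipoder g; rewrite comul_dist (tens_lift_otimes bil) counit_dist scale1r.
Qed.

(** The right-hand side is an invariant functional with value 1 at L, so uniqueness applies.
    Invariance is checked after applying the injective S, where it becomes [lam_dist] for S(y) g. *)
Lemma lam_antipode y : lam y = lam (S y * g).
Proof.
pose f x := lam (S x * g).
have hf : scalar f by move=> c x z; rewrite /f linearP mulrDl -scalerAl linearP.
have fE x : mk_scalar hf x = f x by [].
have fL : f L = 1 by rewrite /f antipode_integral Lmul counit_dist scale1r lam_integral.
suff h x : tens_ctl (mk_scalar hf) (Delta x) = mk_scalar hf x *: 1.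
  by rewrite -[RHS]/(mk_scalar hf y) (lam_unique h) fE fL mul1r.
move: x; apply: linear_comul_mx_ext => [c x z|c x z|i j].
- by rewrite !linearP.
- by rewrite linearP scalerDl scalerA.
apply: antipode_inj; rewrite tens_ctl_comul_mx linear_sum linearZ antipode1 /=.
have : tens_ctr lam (Delta (S (t i j) * g)) = lam (S (t i j) * g) *: g.
  exact: lam_dist.
rewrite rmorphM /= comul_antipode_mx comul_dist mulr_suml linear_sum.
move=> /(congr1 (fun x => x * S g)).
rewrite -scalerAl antipode_distr => <-; rewrite mulr_suml.
apply: eq_bigr => l _; rewrite linearZ /= otimesM tens_ctrE -scalerAl.
by rewrite -mulrA antipode_distr mulr1.
Qed.

(** Radford's formula. Test both sides against lam(_ x): by [lam_nakayama] and [lam_antipode] both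
    become lam(S(x) g S(y)). *)
Lemma antipode_pow4 y : S (S (S (S y))) = g * y * S g.
Proof.
apply/eqP; rewrite -subr_eq0; apply/eqP; apply: lam_nondegl => x.
rewrite mulrBl linearB /=; apply/eqP; rewrite subr_eq0; apply/eqP.
have SSg : S (S g) = g.
  have : S g * S (S g) = 1 by rewrite -antipodeM antipode_distl antipode1.
  by move=> /(congr1 (fun z => g * z)); rewrite mulrA antipode_distr mul1r mulr1.
rewrite -lam_nakayama lam_antipode antipodeM.
rewrite -(mulrA _ (S x)) -lam_nakayama.
rewrite [RHS]lam_antipode !antipodeM SSg.
by rewrite -!mulrA antipode_distl mulr1.
Qed.

End TwoSided.
End Integral.

(** * Semisimple algebras *)

Section CentralTrace.
Variables (k : fieldType) (C : falgType k).
Hypothesis ch0 : [pchar k] =i pred0.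
Hypothesis reduced_center :
  forall c : C, (forall x, c * x = x * c) -> c * c = 0 -> c = 0.

Section Representation.
Variables (n' : nat) (rho : {linear C -> 'M[k]_n'.+1}).
Hypothesis rho1 : rho 1 = 1.
Hypothesis rhoM : forall x y, rho (x * y) = rho x * rho y.
Hypothesis rho_inj : injective rho.

Lemma rhoX x i : rho (x ^+ i) = rho x ^+ i.
Proof. by elim: i => [|i IHi]; rewrite ?rho1 // !exprS rhoM IHi. Qed.

Lemma horner_mx_central c p : (forall x, c * x = x * c) ->
  exists2 x, horner_mx (rho c) p = rho x & forall y, x * y = y * x.
Proof.
move=> hc; elim/poly_ind: p => [|p a [x Ex hx]].
  by exists 0; rewrite ?rmorph0 ?linear0 // => y; rewrite mul0r mulr0.
exists (x * c + a%:A).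
  rewrite rmorphD rmorphM /= Ex horner_mx_X horner_mx_C linearD rhoM; congr (_ + _).
  by rewrite linearZ rho1 -[1]/(1%:M) /= scalemx1.
by move=> y; rewrite mulrDl mulrDr -mulrA hc mulrA hx mulrA -scalerAl -scalerAr mul1r mulr1.
Qed.

(** If the minimal polynomial is q d^2, then (q d)(c) is central with square zero, hence zero, so d
    is constant by minimality of the degree. *)
Lemma separable_mxminpoly_central c : (forall x, c * x = x * c) ->
  separable_poly (mxminpoly (rho c)).
Proof.
move=> hc; have p0 : mxminpoly (rho c) != 0 by apply/monic_neq0/mxminpoly_monic.
apply/separable_polyP; split=> [u v uv|u up su].
  have dd : gcdp u v * gcdp u v %| mxminpoly (rho c).
    by apply: dvdp_trans uv; apply: dvdp_mul; rewrite ?dvdp_gcdl ?dvdp_gcdr.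
  case/dvdpP: dd => q Eq; set d := gcdp u v in Eq.
  have [x Ex hx] := horner_mx_central (q * d) hc.
  have x0 : x = 0.
    apply: reduced_center => //; apply: rho_inj; rewrite rhoM -Ex -rmorphM.
    have -> : q * d * (q * d) = q * mxminpoly (rho c).
      by rewrite Eq -!mulrA; congr (_ * _); rewrite mulrCA !mulrA.
    by rewrite rmorphM /= mx_root_minpoly mulr0 linear0.
  have := mxminpoly_min (A := rho c) (p := q * d).
  rewrite Ex x0 linear0 => /(_ erefl) dvd.
  have qd0 : q * d != 0.
    by apply: contraNneq p0; rewrite Eq mulrA => ->; rewrite mul0r.
  have d0 : d != 0 by apply: contraNneq qd0 => ->; rewrite mulr0.
  have := dvdp_leq qd0 dvd; rewrite {1}Eq mulrA size_mul //.
  rewrite /coprimep -/d; move: d0; rewrite -size_poly_gt0.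
  case: (size d) => [|[|s]] // _; rewrite !addnS /= ltnNge leq_addr //.
apply: contraTneq su => /polyP/(_ (size u).-2); rewrite coef_deriv coef0.
case E: (size u) => [|[|s]] //= /eqP; rewrite -mulr_natr mulf_eq0.
have -> : u`_s.+1 = lead_coef u by rewrite lead_coefE E.
by rewrite ((pcharf0P k).1 ch0) orbF lead_coef_eq0 -size_poly_eq0 E.
Qed.

Lemma trace_central_eq0_mx (v w P : C) (N : nat) :
  (0 < N)%N -> v * w = 1 -> w * v = 1 ->
  (forall x, P * x = x * P) -> (forall x, v ^+ N * x = x * v ^+ N) ->
  (forall c, (forall x, c * x = x * c) -> \tr (rho (v * c)) = \tr (rho (P * c))) ->
  \tr (rho (P * w)) = 0 -> P = 0.
Proof.
move=> N0 vw wv hP hv htr tr0.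
have uv : rho v \is a GRing.unit.
  by apply/unitrP; exists (rho w); rewrite -!rhoM vw wv rho1.
have Ew : rho w = (rho v)^-1.
  by rewrite -[LHS]mulr1 -(mulrV uv) mulrA -rhoM wv rho1 mul1r.
apply: rho_inj; rewrite linear0.
apply: (mxtrace_mul_inv_eq0 (N := N) (A := rho v)) => //.
- by rewrite -!rhoM hP.
- exact: separable_mxminpoly_central.
- by rewrite -rhoX; apply: separable_mxminpoly_central.
- move=> i j; rewrite -!rhoX -!rhoM htr // => x.
  have comX (c y : C) l : c * y = y * c -> c ^+ l * y = y * c ^+ l.
    by move=> cy; apply/esym/commrX.
  by rewrite -mulrA (comX _ _ j (hv x)) mulrA (comX _ _ i (hP x)) mulrA.
- by rewrite -Ew -rhoM.
Qed.
End Representation.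

Lemma trace_central_eq0 (v w P : C) (N : nat) :
  (0 < N)%N -> v * w = 1 -> w * v = 1 ->
  (forall x, P * x = x * P) -> (forall x, v ^+ N * x = x * v ^+ N) ->
  (forall c, (forall x, c * x = x * c) ->
    ftrace (fun h : C => v * c * h) = ftrace (fun h : C => P * c * h)) ->
  ftrace (fun h : C => P * w * h) = 0 -> P = 0.
Proof.
move=> N0 vw wv hP hv htr tr0.
pose r (x : C) := fmx (fun h : C => x * h).
have lin (x : C) : linear (fun h : C => x * h).
  by move=> a y z; rewrite mulrDr scalerAr.
have rlin : linear r.
  move=> a x y; apply/matrixP=> i j; rewrite !mxE mulrDl -scalerAl.
  by rewrite linearP.
have r1 : r 1 = 1%:M.
  by rewrite -fmx_id; congr fmx; apply/funext => h; rewrite mul1r.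
have rM x y : r (x * y) = r x *m r y.
  by rewrite -fmx_comp //; congr fmx; apply/funext => h /=; rewrite mulrA.
have rinj : injective r.
  move=> x y /(fmx_inj (lin x) (lin y))/(_ 1) /=.
  by rewrite !mulr1.
have rtr x : ftrace (fun h : C => x * h) = \tr (r x) by exact: ftraceE.
have m0 : (0 < \dim {:C})%N.
  rewrite lt0n dimv_eq0; apply: contraNneq (oner_neq0 C) => full0.
  by rewrite -memv0 -full0 memvf.
have {}htr c : (forall x, c * x = x * c) -> \tr (r (v * c)) = \tr (r (P * c)).
  by rewrite -!rtr; apply: htr.
have {}tr0 : \tr (r (P * w)) = 0 by rewrite -rtr.
(* The regular representation is made abstract so that its dimension can be rewritten as a
   successor, as the ring of square matrices requires. *)
clearbody r; clear rtr lin; move: r rlin r1 rM rinj htr tr0.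
case: (\dim {:C}) m0 => // n' _ r rlin r1 rM rinj htr tr0.
exact: (@trace_central_eq0_mx n' (mk_linear rlin) r1 rM rinj v w P N).
Qed.

End CentralTrace.

(** * The regular character of a semisimple algebra *)

Section LeftTrace.
Variables (k : fieldType) (C : falgType k).

Definition ltr (x : C) : k := ftrace (fun h => x * h).

Fact ltr_scalar : scalar ltr.
Proof.
move=> a x y; rewrite /ltr /ftrace mulr_sumr -big_split; apply: eq_bigr => i _ /=.
by rewrite mulrDl -scalerAl linearP.
Qed.
HB.instance Definition _ := GRing.isLinear.Build k C k *%R ltr ltr_scalar.

Lemma mull_linear (x : C) : linear (fun h => x * h).
Proof. by move=> a y z; rewrite mulrDr scalerAr. Qed.

Lemma mulr_linear (x : C) : linear (fun h => h * x).
Proof. by move=> a y z; rewrite mulrDl scalerAl. Qed.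

Lemma ltrM (x y : C) : ltr (x * y) = ltr (y * x).
Proof.
transitivity (ftrace ((fun h => x * h) \o (fun h => y * h))).
  by apply: eq_ftrace => h /=; rewrite mulrA.
rewrite ftraceC; [|exact: mull_linear|exact: mull_linear].
by apply: eq_ftrace => h /=; rewrite mulrA.
Qed.

Lemma ltr1 : ltr 1 = (\dim {:C})%:R.
Proof.
rewrite /ltr ftraceE (_ : fmx _ = 1%:M) ?mxtrace1 // -fmx_id.
by congr fmx; apply/funext => h; rewrite mul1r.
Qed.

Hypothesis ss : semisimple C.

(** The left ideal C c has a right unit x c, so c = c x c = x c c = 0. *)
Lemma semisimple_reduced_center (c : C) :
  (forall x, c * x = x * c) -> c * c = 0 -> c = 0.
Proof.
move=> hc cc; pose I : {vspace C} := (fullv * <[c]>)%VS.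
have [|u /memv_cosetP[x _ ->] hu] := @semisimple_left_ideal_unit k C I ss.
  by rewrite prodvA prodvSl // subvf.
rewrite (hu c); last by apply/memv_cosetP; exists 1; rewrite ?memvf ?mul1r.
by rewrite mulrA hc -mulrA cc mulr0.
Qed.

Hypothesis ch0 : [pchar k] =i pred0.

(** The radical of the trace form is a left ideal, so it has an idempotent right unit u. Its trace 0
    is the rank of left multiplication by u, so u = 0 in characteristic 0. *)
Lemma ltr_nondeg (x : C) : (forall y, ltr (x * y) = 0) -> x = 0.
Proof.
pose f (x : C) : 'rV[k]_(\dim {:C}) := \row_i ltr (x * (vbasis {:C})`_i).
have hf : linear f.
  by move=> a y z; apply/rowP=> i; rewrite !mxE mulrDl -scalerAl linearP.
pose I := lker (linfun (mk_linear hf)).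
have inI y : reflect (forall z, ltr (y * z) = 0) (y \in I).
  rewrite memv_ker lfunE; apply: (iffP eqP) => [/= fy z|h]; last first.
    by apply/rowP=> i; rewrite !mxE h.
  rewrite (vbasis_sum z) mulr_sumr linear_sum big1 // => i _.
  by rewrite -scalerAr linearZ /=; have /rowP/(_ i) := fy; rewrite !mxE => ->; rewrite mulr0.
have [|u /inI uI hu] := semisimple_left_ideal_unit ss (I := I).
  apply: left_idealP => y z /inI zI; apply/inI => z'.
  by rewrite -mulrA ltrM -mulrA zI.
have uu : u = u * u by apply: hu; apply/inI.
suff u0 : u = 0 by move=> /inI/hu ->; rewrite u0 mulr0.
have idem : fmx (fun h : C => u * h) *m fmx (fun h => u * h) = fmx (fun h => u * h).
  rewrite -fmx_comp; last exact: mull_linear.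
  by congr fmx; apply/funext => h /=; rewrite mulrA -uu.
have := uI 1; rewrite mulr1 /ltr ftraceE mxtrace_idem // => /eqP.
rewrite ((pcharf0P k).1 ch0) mxrank_eq0 => /eqP E.
have := @fmx_inj _ _ (fun h => u * h) (fun=> 0) (mull_linear u) _ _ 1.
rewrite mulr1; apply; first by move=> a y z; rewrite scaler0 addr0.
by rewrite E; apply/matrixP=> i j; rewrite !mxE linear0.
Qed.

End LeftTrace.

(** For the commuting projectors E = (1 + s)/2 and p = q/n, traces are ranks, so 2 rk E + n rk p = n
    + 2 n rk(E p). Hence 2 rk E is 0, n or 2n. The value 0 means s = -1 and n means tr s = 0, so E =
    1. *)
Lemma mxtrace_involution (k : fieldType) (n : nat) (s q : 'M[k]_n) :
  [pchar k] =i pred0 -> s *m s = 1%:M -> q *m q = n%:R *: q -> s *m q = q *m s ->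
  \tr (s *m q) = \tr s -> \tr s != 0 -> s != -1%:M -> s = 1%:M.
Proof.
move=> ch0 ss qq sq trq tr0 s1.
have nat0 := (pcharf0P k).1 ch0.
have n0 : n%:R != 0 :> k.
  rewrite nat0; apply: contraNneq tr0 => n0.
  by rewrite /mxtrace big1 // => i; have := ltn_ord i; rewrite {2}n0.
have two0 : 2%:R != 0 :> k by rewrite nat0.
pose E := 2%:R^-1 *: (1%:M + s).
pose p := n%:R^-1 *: q.
have EE : E *m E = E.
  rewrite /E -scalemxAl -scalemxAr mulmxDl !mulmxDr !mul1mx mulmx1 ss [s + _]addrC.
  rewrite -mulr2n -scaler_nat; congr (_ *: _).
  by rewrite scalerA mulVf // scale1r.
have pp : p *m p = p.
  by rewrite /p -scalemxAl -scalemxAr qq !scalerA mulfVK.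
have Ep : E *m p = p *m E.
  by rewrite /E /p -!scalemxAl -!scalemxAr mulmxDl mulmxDr mul1mx mulmx1 sq !scalerA [_ * _]mulrC.
have EpEp : (E *m p) *m (E *m p) = E *m p.
  by rewrite {2}Ep mulmxA -(mulmxA E) pp -mulmxA -Ep mulmxA EE.
have trE : 2%:R * (\rank E)%:R = n%:R + \tr s :> k.
  by rewrite -(mxtrace_idem EE) /E mxtraceZ mulrA mulfV // mul1r mxtraceD mxtrace1.
have trEp : 2%:R * n%:R * (\rank (E *m p))%:R = n%:R * (\rank p)%:R + \tr s :> k.
  have En : n%:R * \tr p = \tr q by rewrite /p mxtraceZ mulrA mulfV ?mul1r.
  have E2 : 2%:R * n%:R * \tr (E *m p) = \tr q + \tr s.
    rewrite /E /p -scalemxAl -scalemxAr !mxtraceZ mulmxDl mul1mx mxtraceD trq.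
    by rewrite mulrACA !mulrA mulfV // mul1r mulfV // mul1r.
  by rewrite -(mxtrace_idem EpEp) -(mxtrace_idem pp) E2 En.
have {trEp} : (2 * \rank E + n * \rank p = n + 2 * n * \rank (E *m p))%N.
  apply: (natr_inj_pchar0 ch0); cbv beta; rewrite (natrD _ (2 * _)) (natrD _ n) !natrM trE trEp.
  by rewrite -!addrA [\tr s + _]addrC.
move=> Enat.
have rle : (\rank E <= n)%N by apply: rank_leq_row.
have r0 : (0 < \rank E)%N.
  rewrite lt0n mxrank_eq0 scaler_eq0 invr_eq0 (negbTE two0) /=.
  by apply: contraNneq s1 => /eqP; rewrite addrC addr_eq0.
have rn : (2 * \rank E)%N != n.
  by apply: contraNneq tr0 => rn; have := trE; rewrite -natrM rn -{1}[n%:R]addr0 => /addrI <-.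
have : (n %| 2 * \rank E)%N.
  rewrite -(dvdn_addl _ (dvdn_mulr (\rank p) (dvdnn n))) Enat.
  by rewrite dvdn_add // mulnAC dvdn_mull.
case/dvdnP => c Ec.
have n1 : (0 < n)%N := leq_trans r0 rle.
have c2 : c = 2%N.
  have : (c <= 2)%N by rewrite -(leq_pmul2r n1) -Ec leq_mul2l rle orbT.
  move: rn r0; rewrite -(ltn_pmul2l (ltn0Sn 1)) muln0 Ec.
  by case: c {Ec} => [|[|[|c]]] //; rewrite mul1n eqxx.
have rE : \rank E = n by apply/eqP; rewrite -(eqn_pmul2l (ltn0Sn 1)) Ec c2.
have fE : row_full E by rewrite /row_full rE.
have E1 : E = 1%:M by apply: (row_full_inj fE); rewrite EE mulmx1.
have : 2%:R *: E = 1%:M + s by rewrite /E scalerA mulfV // scale1r.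
rewrite E1 scaler_nat mulr2n => /addrI.
by move->.
Qed.

(** * Semisimple Hopf algebras in characteristic 0 are involutive *)

Section HopfSquare.
Variables (k : fieldType) (H : hopfAlgebra k).
Notation m := (\dim {:H}).
Notation e := (vbasis {:H}).
Notation Delta := (@comul k H).
Notation eps := (@counit k H).
Notation S := (@antipode k H).
Notation t := (@comul_mx k H).

(* If g^d is the first power that depends linearly on the previous ones, then
   comparing Delta(g^d) with the tensor square of the relation shows that g^d is
   one of them. *)
Lemma grouplike_finite_order (g g' : H) : Delta g = g ⊗ g -> g' * g = 1 ->
  exists2 n, (0 < n)%N & g ^+ n = 1.
Proof.
move=> Dg g'g.
have DgX i : Delta (g ^+ i) = g ^+ i ⊗ g ^+ i.
  by elim: i => [|i IHi]; rewrite ?rmorph1 // !exprS rmorphM /= IHi Dg otimesM.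
have g'X i j : g' ^+ i * g ^+ (i + j) = g ^+ j.
  elim: i => [|i IHi]; first by rewrite mul1r.
  by rewrite exprSr addSn exprS -mulrA (mulrA g') g'g mul1r IHi.
pose X d := [tuple g ^+ (i : 'I_d) | i < d].
have XE d : X d = mkseq (fun i => g ^+ i) d :> seq H.
  by rewrite /X /= /mkseq -val_enum_ord -map_comp.
have XS d : perm_eq (X d.+1) (g ^+ d :: X d).
  by rewrite !XE mkseqS perm_rcons.
have ex : exists d, ~~ free (X d.+1).
  exists m; apply: contraT; rewrite negbK /free size_tuple => /eqP E.
  by have := dimvS (subvf <<X m.+1>>%VS); rewrite E ltnn.
case: (ex_minnP ex) => d nfree min.
have freeX : free (X d).
  case: d nfree min => [|d] _ min; first by rewrite XE nil_free.
  by apply: contraT => /min; rewrite ltnn.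
move: nfree; rewrite (perm_free (XS d)) free_cons freeX andbT negbK => /coord_span.
move=> gd.
have nthX (i : 'I_d) : (X d)`_i = g ^+ i by rewrite -tnth_nth tnth_mktuple.
have cX (i j : 'I_d) : coord (X d) i (g ^+ j) = (i == j)%:R.
  by rewrite -nthX coord_free // eq_sym.
have rel i j : coord (X d) i (g ^+ d) * coord (X d) j (g ^+ d) = (i == j)%:R * coord (X d) i (g ^+ d).
  transitivity (coord (X d) i (tens_ctr (coord (X d) j) (Delta (g ^+ d)))).
    by rewrite DgX tens_ctrE linearZ_LR mulrC.
  have val (l : 'I_d) :
      coord (X d) i (tens_ctr (coord (X d) j) (Delta (g ^+ l))) = (j == l)%:R * (i == l)%:R.
    by rewrite DgX tens_ctrE linearZ_LR /= !cX.
  rewrite {1}gd [Delta _]linear_sum [tens_ctr _ _]linear_sum [LHS]linear_sum (bigD1 j) // big1 ?addr0 => [|l /andP[_ lj]].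
    rewrite nthX !linearZ_LR /= val eqxx mul1r [LHS]addr0 [LHS]mulrC.
    by case: eqVneq => [->|]; rewrite ?mul0r.
  by rewrite nthX !linearZ_LR /= val eq_sym (negbTE lj) mul0r; apply: mulr0.
have [i ci|all0] := pickP (fun i => coord (X d) i (g ^+ d) != 0); last first.
  have gd0 : g ^+ d = 0.
    by rewrite gd big1 // => i _; rewrite (eqP (negbFE (all0 i))) scale0r.
  have := g'X d 0%N; rewrite addn0 gd0 mulr0 => /esym/eqP.
  by rewrite oner_eq0.
have gdi : g ^+ d = g ^+ i.
  rewrite gd (bigD1 i) //= nthX big1 ?addr0 => [|l li].
    by have := rel i i; rewrite eqxx mul1r -[X in _ = X]mulr1 => /(mulfI ci) ->; rewrite scale1r.
  have := rel i l; rewrite eq_sym (negbTE li) mul0r => /eqP.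
  by rewrite mulf_eq0 (negbTE ci) /= => /eqP->; rewrite scale0r.
exists (d - i)%N; first by rewrite subn_gt0.
have := g'X i (d - i)%N; rewrite subnKC ?(ltnW (ltn_ord i)) // gdi => <-.
by have := g'X i 0%N; rewrite addn0.
Qed.

Definition antipode_flip (u : tens H H) : tens H H :=
  tens_lift (fun x y => S y ⊗ S x) u.

Lemma antipode_flip_bilin : bilin (fun x y : H => S y ⊗ S x).
Proof.
split=> [u u' v|u v v'|u a v]; rewrite ?linearD ?otimesDl ?otimesDr //.
by rewrite !linearZ /= otimesZ.
Qed.

Fact antipode_flip_linear : linear antipode_flip.
Proof.
have bil := antipode_flip_bilin; move=> a u v.
rewrite /antipode_flip (tens_liftD bil); congr (_ + _).
elim/tens_ind: u => [|x y u IHu]; first by rewrite scaler0 (tens_lift0 bil) scaler0.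
rewrite scalerDr !(tens_liftD bil) IHu scalerDr; congr (_ + _).
by rewrite -otimesZl !(tens_lift_otimes bil) linearZ /= otimesZr.
Qed.
HB.instance Definition _ :=
  GRing.isLinear.Build k (tens H H) (tens H H) *:%R antipode_flip antipode_flip_linear.

Lemma antipode_flipE x y : antipode_flip (x ⊗ y) = S y ⊗ S x.
Proof. exact: tens_lift_otimes antipode_flip_bilin x y. Qed.

Lemma comul_antipode x : Delta (S x) = antipode_flip (Delta x).
Proof.
move: x; apply: linear_comul_mx_ext => [a x y|a x y|i j].
- by rewrite !linearP.
- by rewrite !linearP.
rewrite comul_antipode_mx comul_comul_mx linear_sum.
by apply: eq_bigr => l _; rewrite [RHS]antipode_flipE.
Qed.

Lemma comul_antipode2_mx i j :
  Delta (S (S (t i j))) = \sum_l S (S (t i l)) ⊗ S (S (t l j)).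
Proof.
rewrite comul_antipode comul_antipode_mx linear_sum.
by apply: eq_bigr => l _; rewrite [LHS]antipode_flipE.
Qed.
End HopfSquare.

(** * Comparison of the integral with the regular character *)

Section Involutive.
Variables (k : fieldType) (H : hopfAlgebra k).
Notation m := (\dim {:H}).
Notation e := (vbasis {:H}).
Notation Delta := (@comul k H).
Notation eps := (@counit k H).
Notation S := (@antipode k H).
Notation t := (@comul_mx k H).
Notation lam := (@lam k H).

(* On characters this is the isomorphism of H-modules H ⊗ M = H^(dim M). *)
Lemma ltr_convolve (f : {scalar H}) (p j : 'I_m) :
  (forall x y, f (x * y) = f (y * x)) ->
  \sum_l ltr (t p l) * f (t l j) = ltr (t p j) * f 1.
Proof.
move=> fC; pose M (x : H) (r i : 'I_m) := coord e r (x * e`_i).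
(* This is Delta(t_pj e_s) = Delta(t_pj) Delta(e_s), read at e_q in the first factor. [E2] then
   cancels the second t by its inverse S(t). *)
have E1 q s : \sum_l \sum_i M (t p l) q i *: (t l j * t i s) =
              \sum_r M (t p j) r s *: t q r.
  transitivity (tens_ctl (coord e q) (Delta (t p j) * Delta e`_s)).
    rewrite comul_comul_mx comul_e big_distrlr /= [RHS]linear_sum.
    apply: eq_bigr => l _; rewrite [RHS]linear_sum; apply: eq_bigr => i _.
    by rewrite otimesM [RHS]tens_ctlE.
  rewrite -rmorphM /= {1}(vbasis_sum (t p j * e`_s)) [Delta _]linear_sum [LHS]linear_sum.
  apply: eq_bigr => r _; rewrite linearZ_LR /= [LHS]linearZ_LR /=.
  by [].

have E2 q u : \sum_l M (t p l) q u *: t l j =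
    \sum_r \sum_s M (t p j) r s *: (t q r * S (t s u)).
  transitivity (\sum_l \sum_i \sum_s M (t p l) q i *: (t l j * t i s * S (t s u))).
    have inner l i : \sum_s M (t p l) q i *: (t l j * t i s * S (t s u)) =
        M (t p l) q i *: (t l j * (i == u)%:R).
      rewrite -antipode_mulr mulr_sumr scaler_sumr.
      by apply: eq_bigr => s _; rewrite mulrA.
    apply: eq_bigr => l _; rewrite (bigD1 u) //= inner eqxx mulr1 big1 ?addr0 //.
    by move=> i /negbTE iu; rewrite inner iu mulr0 scaler0.
  transitivity (\sum_s (\sum_l \sum_i M (t p l) q i *: (t l j * t i s)) * S (t s u)).
    under [RHS]eq_bigr => s _.
      rewrite mulr_suml; under eq_bigr => l _ do rewrite mulr_suml.
      over.
    rewrite [RHS]exchange_big; apply: eq_bigr => l _ /=.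
    rewrite [RHS]exchange_big; apply: eq_bigr => i _ /=.
    by apply: eq_bigr => s _; rewrite scalerAl.
  under eq_bigr => s _ do rewrite E1 mulr_suml.
  rewrite exchange_big; apply: eq_bigr => r _ /=.
  by apply: eq_bigr => s _; rewrite scalerAl.
have ltrE x : ltr x = \sum_q M x q q by [].
transitivity (\sum_q f (\sum_l M (t p l) q q *: t l j)).
  under [RHS]eq_bigr => q _ do rewrite linear_sum.
  rewrite exchange_big; apply: eq_bigr => l _ /=.
  by rewrite ltrE mulr_suml; apply: eq_bigr => q _; rewrite linearZ.
under eq_bigr => q _.
  rewrite E2 linear_sum; under eq_bigr => r _ do rewrite linear_sum; over.
(* On the diagonal the symmetry of [f] turns f(t_qr S(t_sq)) into f(S(t_sq) t_qr), whose sum over q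
   is the Kronecker delta times f(1). *)
rewrite exchange_big /= ltrE mulr_suml; apply: eq_bigr => r _.
rewrite exchange_big /= (bigD1 r) //= [X in _ + X]big1 ?addr0 => [|s /negbTE sr].
  transitivity (M (t p j) r r * f (\sum_q S (t r q) * t q r)).
    by rewrite linear_sum mulr_sumr; apply: eq_bigr => q _; rewrite linearZ /= fC.
  by rewrite antipode_mull eqxx.
transitivity (M (t p j) r s * f (\sum_q S (t s q) * t q r)).
  by rewrite linear_sum mulr_sumr; apply: eq_bigr => q _; rewrite linearZ /= fC.
by rewrite antipode_mull sr linear0 mulr0.
Qed.

Section TwoSided.
Variable L : H.
Hypothesis mulL : forall h, h * L = eps h *: L.
Hypothesis Lmul : forall h, L * h = eps h *: L.
Hypothesis epsL : eps L = 1.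
Notation a := (fun s : 'I_m => tens_ctr (coord e s) (Delta L)).
Hypothesis ch0 : [pchar k] =i pred0.
Hypothesis ss : semisimple H.

Lemma ltr_integral : ltr L = 1.
Proof.
rewrite -epsL {2}(vbasis_sum L) linear_sum; apply: eq_bigr => i _.
by rewrite Lmul !linearZ /= mulrC.
Qed.

(** Represent [ltr] as lam(_ v); nondegeneracy of [ltr] makes v invertible. Symmetry of [ltr]
    against [lam_nakayama] gives S^2(y) v = v y. *)
Lemma regular_trace_element : exists v w : H,
  [/\ v * w = 1, w * v = 1, forall h, ltr h = lam (h * v) &
      forall y, S (S y) * v = v * y].
Proof.
have [v hv'] := functional_lam mulL epsL (@ltr k H).
have hv h : ltr h = lam (h * v) := hv' h.
have v_inj x : x * v = 0 -> x = 0.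
  move=> xv; apply: (ltr_nondeg ss ch0) => y.
  by rewrite ltrM hv -mulrA xv mulr0 linear0.
have hS y : S (S y) * v = v * y.
  apply/eqP; rewrite -subr_eq0; apply/eqP/(lam_nondegr mulL epsL) => x.
  apply/eqP; rewrite mulrBr linearB /= subr_eq0; apply/eqP.
  by rewrite mulrA -hv ltrM hv -mulrA -lam_nakayama mulrA.
have k0 : lker (linfun (mk_linear (mulr_linear v))) == 0%VS.
  apply/lker0P => x y; rewrite !lfunE /= => xy; apply/eqP; rewrite -subr_eq0.
  by apply/eqP/v_inj; rewrite mulrBl xy subrr.
pose w := ((linfun (mk_linear (mulr_linear v)))^-1)%VF 1.
have wv : w * v = 1.
  have /lfunP/(_ 1) := lker0_compfV k0.
  by rewrite comp_lfunE id_lfunE lfunE.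
exists v, w; split=> //.
apply/eqP; rewrite -subr_eq0; apply/eqP/v_inj.
by rewrite mulrBl -mulrA wv mulr1 mul1r subrr.
Qed.

(** Squaring the relation gives v^2 y = S^4(y) v^2 = g y S(g) v^2, so v^(2n) is central once g^n =
    1. *)
Lemma antipode_even_power_central v : (forall y, S (S y) * v = v * y) ->
  exists2 N, (0 < N)%N & forall y, v ^+ N * y = y * v ^+ N.
Proof.
move=> hv; pose g := dist_grouplike L.
have gS : S g * g = 1 := antipode_distl mulL epsL.
have [n n0 gn] := grouplike_finite_order (comul_dist mulL epsL) gS.
exists n.*2; first by rewrite double_gt0.
have Sgn : S g ^+ n = 1.
  have <- : S (g ^+ n) = S g ^+ n.
    elim: (n) => [|i IHi]; first by rewrite antipode1.
    by rewrite exprS antipodeM IHi -exprSr.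
  by rewrite gn antipode1.
have v2 y : v ^+ 2 * y = g * y * S g * v ^+ 2.
  rewrite -(antipode_pow4 mulL Lmul epsL) expr2 -(mulrA v v y) -(hv y) mulrA.
  by rewrite -(hv (S (S y))) -!mulrA.
have vn i y : v ^+ i.*2 * y = g ^+ i * y * S g ^+ i * v ^+ i.*2.
  elim: i => [|i IHi] in y *; first by rewrite !mul1r !mulr1.
  have -> : v ^+ i.+1.*2 = v ^+ 2 * v ^+ i.*2 by rewrite -exprD.
  by rewrite -mulrA IHi (mulrA (v ^+ 2)) v2 (exprS g) (exprSr (S g)) !mulrA.
by move=> y; rewrite vn gn Sgn mul1r mulr1.
Qed.

(** The trace [f h] of x |-> v x h is symmetric in products, so it is ltr(P h) with P = u w central.
    It agrees with ltr(v h) on central h, and f(w) = tr(S^2) = lam(1). Were this 0,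
    [trace_central_eq0] would give P = 0, against f(L) = eps(v), which is nonzero as v is
    invertible. *)
Lemma lam1_neq0 : lam 1 != 0.
Proof.
apply/negP => /eqP lam1.
have [v [w [vw wv hv hS]]] := regular_trace_element.
have [N N0 hN] := antipode_even_power_central hS.
pose f h := ftrace (fun x : H => v * x * h).
have hf : scalar f.
  move=> c x y; rewrite /f /ftrace mulr_sumr -big_split; apply: eq_bigr => i _ /=.
  by rewrite mulrDr -scalerAr linearP.
have [u hu] := functional_lam mulL epsL (mk_scalar hf).
have {}hu h : f h = ltr (u * w * h).
  by rewrite ltrM hv -mulrA -(mulrA u) wv mulr1 -hu.
have fC x y : f (x * y) = f (y * x).
  transitivity (ftrace ((fun h => h * y) \o (fun h => v * h * x))).
    by apply: eq_ftrace => h /=; rewrite mulrA.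
  rewrite ftraceC; first by apply: eq_ftrace => h /=; rewrite !mulrA.
    exact: mulr_linear.
  by move=> c z z'; rewrite mulrDr mulrDl -scalerAr -scalerAl.
have P0 : u * w = 0.
  apply: (trace_central_eq0 ch0 (semisimple_reduced_center ss) N0 vw wv) => //.
  - move=> h; apply/eqP; rewrite -subr_eq0; apply/eqP/(ltr_nondeg ss ch0) => y.
    apply/eqP; rewrite mulrBl linearB /= subr_eq0; apply/eqP.
    by rewrite -mulrA -hu fC -[in RHS]mulrA ltrM -mulrA -hu.
  - move=> c hc; rewrite -[RHS]/(ltr _) -hu; apply: eq_ftrace => h.
    by rewrite -!mulrA hc.
  - rewrite -[LHS]/(ltr _) -hu -lam1; apply: eq_ftrace => x.
    by rewrite mulr1 -hS -mulrA vw mulr1.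
have : f L = eps v.
  rewrite /f -[RHS]mulr1 -epsL -[eps L]/(eps L) {2}(vbasis_sum L) linear_sum mulr_sumr.
  apply: eq_bigr => i _; rewrite mulL rmorphM /= !linearZ /= -mulrA.
  by congr (_ * _); apply: mulrC.
rewrite hu P0 mul0r linear0 => /esym ev.
have := congr1 eps vw; rewrite rmorphM rmorph1 /= ev mul0r => /esym/eqP.
by rewrite oner_eq0.
Qed.

Lemma dist_grouplike1 : dist_grouplike L = 1.
Proof.
have := lam_dist mulL epsL 1; rewrite rmorph1 -otimes1 tens_ctrE => E.
by apply: (scalerI lam1_neq0).
Qed.

Lemma antipode4 y : S (S (S (S y))) = y.
Proof.
by rewrite (antipode_pow4 mulL Lmul epsL) dist_grouplike1 antipode1 mul1r mulr1.
Qed.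

Lemma ltr_antipode2 y : ltr (S (S y)) = ltr y.
Proof.
have [v [w [vw wv _ hS]]] := regular_trace_element.
by rewrite -[S (S y)]mulr1 -vw mulrA hS ltrM mulrA wv mul1r.
Qed.

Notation Q := (fun h => tens_ctr (@ltr k H) (Delta h)).

Lemma ltr_op_linear : linear Q.
Proof. by move=> c x y; rewrite !linearP. Qed.

(** [Q] is convolution with the regular character, whose convolution square is dim H times itself by
    [ltr_convolve]. *)
Lemma ltr_op_idem h : Q (Q h) = m%:R *: Q h.
Proof.
move: h; apply: linear_comul_mx_ext => [c x y|c x y|i j].
- by rewrite !linearP.
- by rewrite !linearP.
rewrite tens_ctr_comul_mx [Delta _]linear_sum [tens_ctr _ _]linear_sum scaler_sumr /=.
transitivity (\sum_p (\sum_l ltr (t p l) * ltr (t l j)) *: t i p).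
  under [RHS]eq_bigr => p _ do rewrite scaler_suml.
  rewrite exchange_big; apply: eq_bigr => l _ /=.
  rewrite linearZ_LR /= linearZ_LR /= tens_ctr_comul_mx scaler_sumr.
  by apply: eq_bigr => p _; rewrite scalerA mulrC.
apply: eq_bigr => p _; rewrite (ltr_convolve (f := @ltr k H)); last exact: ltrM.
by rewrite /= ltr1 scalerA mulrC.
Qed.

Lemma ltr_op_antipode2 h : Q (S (S h)) = S (S (Q h)).
Proof.
move: h; apply: linear_comul_mx_ext => [c x y|c x y|i j].
- by rewrite !linearP.
- by rewrite !linearP.
rewrite comul_antipode2_mx tens_ctr_comul_mx !linear_sum; apply: eq_bigr => l _ /=.
by rewrite tens_ctrE /= ltr_antipode2 !linearZ.
Qed.

(** Writing coordinates as lam(S(x) a_s) and applying [lam_nakayama] turns the trace into lam(L_1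
    S(L_2)) ltr(L_3) = lam(1) ltr(L), with ltr(L) = 1. *)
Lemma trace_antipode2_ltr_op : ftrace (fun h => S (S (Q h))) = lam 1.
Proof.
(* [th l x] is the e_l-coordinate of x_1 ltr(x_2); the claim [h] below is x_1 S(x_2) ltr(x_3) =
   ltr(x) 1. *)
pose th l x := ltr (tens_ctl (coord e l) (Delta x)).
have hth l : scalar (th l) by move=> c x y; rewrite /th !linearP.
have thE l x : mk_scalar (hth l) x = th l x by [].
have h x : \sum_l tens_ctr (mk_scalar (hth l)) (Delta x) * S e`_l = ltr x *: 1.
  move: x; apply: linear_comul_mx_ext => [c x y|c x y|i j].
  - rewrite scaler_sumr -big_split; apply: eq_bigr => l _ /=.
    by rewrite [Delta _]linearP (tens_ctr_linear (mk_scalar (hth l))) mulrDl scalerAl.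
  - by rewrite linearP scalerDl scalerA.
  transitivity (\sum_q ltr (t q j) *: \sum_r t i r * S (t r q)).
    under eq_bigr => l _ do rewrite tens_ctr_comul_mx mulr_suml.
    rewrite exchange_big /=; under [RHS]eq_bigr => q _ do rewrite scaler_sumr.
    rewrite [RHS]exchange_big; apply: eq_bigr => r _ /=.
    transitivity (\sum_l \sum_q (coord e l (t r q) * ltr (t q j)) *: (t i r * S e`_l)).
      apply: eq_bigr => l _; rewrite ?thE /th comul_comul_mx [tens_ctl _ _]linear_sum (linear_sum (@ltr k H)).
      rewrite scaler_suml mulr_suml; apply: eq_bigr => q _ /=.
      by rewrite tens_ctlE linearZ /= scalerAl.
    rewrite exchange_big; apply: eq_bigr => q _ /=.
    rewrite [in RHS](vbasis_sum (t r q)) [S _ in RHS]linear_sum mulr_sumr scaler_sumr.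
    by apply: eq_bigr => l _; rewrite linearZ /= -scalerAr scalerA mulrC.
  rewrite (bigD1 i) //= antipode_mulr eqxx big1 ?addr0 // => q /negbTE qi.
  by rewrite antipode_mulr eq_sym qi scaler0.
transitivity (\sum_s \sum_l ltr (t l s) * lam (a s * S e`_l)).
  apply: eq_bigr => s _; rewrite -(lam_antipode_coord mulL epsL) comul_e.
  rewrite [tens_ctr _ _]linear_sum !linear_sum mulr_suml linear_sum.
  apply: eq_bigr => l _ /=; rewrite tens_ctrE !linearZ -scalerAl linearZ /=.
  by rewrite -lam_nakayama.
rewrite exchange_big /=.
transitivity (\sum_l lam (tens_ctr (mk_scalar (hth l)) (Delta L) * S e`_l)).
  apply: eq_bigr => l _; rewrite [in RHS](comul_integral L).
  rewrite (linear_sum (tens_ctr (mk_scalar (hth l)))) mulr_suml (linear_sum lam).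
  apply: eq_bigr => s _; rewrite /= (tens_ctrE (mk_scalar (hth l))) -scalerAl linearZ /=.
  by rewrite /th comul_e (tens_ctl_sum (fun i => t i s)).
by rewrite -linear_sum h ltr_integral scale1r.
Qed.

Lemma antipode2 y : S (S y) = y.
Proof.
have hS : linear (S \o S) by exact: antipodeK2_linear.
have hid : linear (id : H -> H) by [].
suff E : fmx (S \o S) = 1%:M by apply: (fmx_inj hS hid); rewrite E fmx_id.
have lamE : \tr (fmx (S \o S)) = lam 1.
  by rewrite -ftraceE; apply: eq_ftrace => h; rewrite mulr1.
apply: (mxtrace_involution (q := fmx Q) ch0).
- rewrite -fmx_comp // -fmx_id; congr fmx; apply/funext => h /=; exact: antipode4.
- rewrite -fmx_comp; last exact: ltr_op_linear.
  by apply/matrixP=> i j; rewrite !mxE /= ltr_op_idem linearZ.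
- rewrite -!fmx_comp //; last exact: ltr_op_linear.
  by congr fmx; apply/funext => h /=; rewrite -ltr_op_antipode2.
- rewrite lamE -fmx_comp // -ftraceE; exact: trace_antipode2_ltr_op.
- by rewrite lamE lam1_neq0.
(* S^2 = -1 is impossible since S^2 fixes 1 and 2 is nonzero. *)
- apply/eqP => E.
  have h0 : linear (fun h : H => - h) by move=> c x y'; rewrite opprD scalerN.
  have EN : fmx (fun h : H => - h) = - 1%:M.
    by rewrite -fmx_id; apply/matrixP=> i j; rewrite !mxE linearN.
  have := fmx_inj hS h0 (etrans E (esym EN)) 1; rewrite /= !antipode1 => /eqP.
  rewrite -subr_eq0 opprK -mulr2n -scaler_nat scaler_eq0 oner_eq0 orbF.
  by rewrite ((pcharf0P k).1 ch0).
Qed.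

End TwoSided.

Lemma semisimple_integrals : [pchar k] =i pred0 -> semisimple H ->
  exists (f : {scalar H}) (L : H),
    [/\ forall x y, f (x * y) = f (y * x),
        forall h, tens_ctr f (Delta h) = f h *: 1,
        forall h, f (L * h) = eps h & S L = L /\ eps L = 1].
Proof.
move=> ch0 ss; have [L [mulL Lmul epsL]] := semisimple_integral ss.
exists lam, L; split.
- by move=> x y /=; rewrite lam_nakayama (antipode2 mulL Lmul epsL ch0 ss).
- by move=> h; rewrite (lam_dist mulL epsL) (dist_grouplike1 mulL Lmul epsL ch0 ss).
- by move=> h; rewrite Lmul linearZ /= (lam_integral mulL epsL) mulr1.
- by split=> //; apply: antipode_integral.
Qed.

End Involutive.

(** * Frobenius structure of a Galois extension *)

Lemma tens_scalerAr (k : fieldType) (M N : algType k) (a : k) (u v : tens M N) :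
  a *: (u * v) = u * (a *: v).
Proof.
elim/tens_ind: v => [|x y v IHv]; first by rewrite scaler0 !mulr0 scaler0.
rewrite mulrDr !scalerDr mulrDr IHv; congr (_ + _) => {v IHv}.
elim/tens_ind: u => [|x' y' u IHu]; first by rewrite !mul0r scaler0.
rewrite !mulrDl scalerDr IHu; congr (_ + _).
by rewrite -otimesZl !otimesM -scalerAr otimesZl.
Qed.

Section Comodule.
Variables (k : fieldType) (H : hopfAlgebra k) (B : comodAlgebra H).
Notation m := (\dim {:H}).
Notation e := (vbasis {:H}).
Notation Delta := (@comul k H).
Notation eps := (@counit k H).
Notation S := (@antipode k H).
Notation rho := (@coact k H B).

Definition coact_comp (i : 'I_m) (b : B) : B := tens_ctr (coord e i) (rho b).
Notation p := coact_comp.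

Lemma coact_sum b : rho b = \sum_i p i b ⊗ e`_i.
Proof. exact: tens_sumr. Qed.

(** Coassociativity followed by id ⊗ phi. It is used with phi(x ⊗ y) = x S(y) and phi(x ⊗ y) = x
    f(y). *)
Lemma coassoc_map (phi : {linear tens H H -> H}) b :
  \sum_i tens_map id phi (tens_assoc (rho (p i b) ⊗ e`_i)) =
  \sum_i p i b ⊗ phi (Delta e`_i).
Proof.
have := coactA b; rewrite [X in tens_map rho _ X]coact_sum [X in tens_map id Delta X]coact_sum.
rewrite (tens_map_sum rho idfun) (tens_map_sum idfun Delta) tens_assoc_sum /=.
move=> /(congr1 (tens_map id phi)).
rewrite (tens_map_sum idfun phi) => <-.
by rewrite (big_morph _ (tens_mapD idfun phi) (tens_map0 idfun phi)).
Qed.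

Lemma coact_counit_sum b : \sum_(i < m) eps e`_i *: p i b = b.
Proof.
have := coact_counit b; rewrite -[LHS]/(tens_ctr eps (rho b)) {1}coact_sum linear_sum.
by move=> {2}<-; apply: eq_bigr => i _; rewrite /= tens_ctrE.
Qed.

Lemma tens_ctr_mull (f : {scalar H}) (x : B) (u : tens B H) :
  tens_ctr f ((x ⊗ 1) * u) = x * tens_ctr f u.
Proof.
rewrite (tens_sumr u) mulr_sumr !linear_sum mulr_sumr; apply: eq_bigr => i _ /=.
by rewrite otimesM mul1r !tens_ctrE scalerAr.
Qed.

Lemma tens_ctr_mulr (f : {scalar H}) (x : B) (u : tens B H) :
  tens_ctr f (u * (x ⊗ 1)) = tens_ctr f u * x.
Proof.
rewrite (tens_sumr u) mulr_suml !linear_sum mulr_suml; apply: eq_bigr => i _ /=.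
by rewrite otimesM mulr1 !tens_ctrE scalerAl.
Qed.

Lemma coact_coinv (a : coinv B) : rho (coinv_val a) = coinv_val a ⊗ 1.
Proof. by apply/eqP; case: a. Qed.

(* y_0 ⊗ y_1 S(y_2) = y ⊗ 1 *)
Lemma coact_antipode b : \sum_i rho (p i b) * (1 ⊗ S e`_i) = b ⊗ 1.
Proof.
pose phi (u : tens H H) : H := tens_lift (fun x y => x * S y) u.
have bil : bilin (fun x y : H => x * S y).
  split=> [x x' y|x y y'|x a y]; first by rewrite mulrDl.
    by rewrite linearD mulrDr.
  by rewrite linearZ /= -scalerAl scalerAr.
have hphi : linear phi.
  move=> a u v; rewrite /phi (tens_liftD bil); congr (_ + _).
  elim/tens_ind: u => [|x y u IHu]; first by rewrite scaler0 (tens_lift0 bil) scaler0.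
  rewrite scalerDr !(tens_liftD bil) IHu scalerDr; congr (_ + _).
  by rewrite -otimesZl !(tens_lift_otimes bil) -scalerAl.
have := coassoc_map (mk_linear hphi) b.
have -> : \sum_i p i b ⊗ mk_linear hphi (Delta e`_i) = b ⊗ 1.
  rewrite -[in RHS](coact_counit_sum b) otimes_suml; apply: eq_bigr => i _.
  by rewrite -[mk_linear _ _]/(phi _) /phi comul_antipoder otimesZ.
move=> <-; apply: eq_bigr => i _.
rewrite (tens_sumr (rho (p i b))) otimes_suml tens_assoc_sum mulr_suml.
under [in RHS]eq_bigr => j _ do rewrite tens_assoc_otimes.
rewrite (tens_map_sum idfun (mk_linear hphi)); apply: eq_bigr => j _.
by rewrite otimesM mulr1 -[mk_linear _ _]/(phi _) /phi (tens_lift_otimes bil).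
Qed.

(** * The conditional expectation onto the coinvariants *)

Section Expectation.
Variables (f : {scalar H}) (L : H).
Hypothesis fC : forall x y, f (x * y) = f (y * x).
Hypothesis f_integral : forall h, tens_ctr f (Delta h) = f h *: 1.
Hypothesis fL : forall h, f (L * h) = eps h.
Hypothesis SL : S L = L.
Hypothesis epsL : eps L = 1.

(** The coaction sends b_0 f(b_1) to b_0 ⊗ b_1 f(b_2), which is b_0 f(b_1) ⊗ 1 since f is an
    integral. *)
Lemma expectation_coinv b : tens_ctr f (rho b) \in @coinv_pred k H B.
Proof.
rewrite /in_mem /= /coinv_pred; apply/eqP.
have := coassoc_map (tens_ctr f) b.
have -> : \sum_i p i b ⊗ tens_ctr f (Delta e`_i) = tens_ctr f (rho b) ⊗ 1.
  rewrite [in RHS]coact_sum linear_sum otimes_suml; apply: eq_bigr => i _ /=.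
  by rewrite f_integral tens_ctrE otimesZ.
move=> <-; rewrite [rho b]coact_sum [tens_ctr _ _]linear_sum [LHS]linear_sum; apply: eq_bigr => i _ /=.
rewrite tens_ctrE linearZ_LR /=.
rewrite (tens_sumr (rho (p i b))) otimes_suml tens_assoc_sum scaler_sumr.
under [in RHS]eq_bigr => j _ do rewrite tens_assoc_otimes.
rewrite (tens_map_sum idfun (tens_ctr f)); apply: eq_bigr => j _.
by rewrite /= tens_ctrE otimesZr.
Qed.

Definition expectation (b : B) : coinv B := Coinv (expectation_coinv b).
Notation E := expectation.

Lemma expectationE b : coinv_val (E b) = tens_ctr f (rho b).
Proof. by []. Qed.

Lemma expectation_mull (a : coinv B) b : E (coinv_val a * b) = a * E b.
Proof.
apply: val_inj; rewrite /= rmorphM /= coact_coinv; exact: tens_ctr_mull.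
Qed.

Lemma expectation_mulr (a : coinv B) b : E (b * coinv_val a) = E b * a.
Proof.
apply: val_inj; rewrite /= rmorphM /= coact_coinv; exact: tens_ctr_mulr.
Qed.

Lemma expectation_sum I (s : seq I) (F : I -> B) :
  E (\sum_(i <- s) F i) = \sum_(i <- s) E (F i).
Proof.
by apply: val_inj; rewrite [RHS]raddf_sum /= [rho _]linear_sum [LHS]linear_sum.
Qed.

(** The list represents the Galois preimage of 1 ⊗ L, so that the (x ⊗ 1) rho(y) sum to 1 ⊗ L. The
    identities follow by multiplying with rho(b) and contracting with f, by applying [Psi], and by
    contracting with eps. *)
Lemma galois_dual_basis : Hopf_Galois B -> exists s : seq (B * B),
  [/\ forall b, \sum_(q <- s) q.1 * coinv_val (E (q.2 * b)) = b,
      forall b, \sum_(q <- s) coinv_val (E (b * q.1)) * q.2 = b &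
      \sum_(q <- s) q.1 * q.2 = 1].
Proof.
case=> inv _ invK; exists (repr (inv (1 ⊗ L))).
set s := repr _.
have Es : \sum_(q <- s) (q.1 ⊗ 1) * rho q.2 = 1 ⊗ L.
  rewrite -[RHS]invK /galois_map /lift; apply: eq_bigr => q _.
  by rewrite galois_innerE.
split.
- move=> b; transitivity (tens_ctr f ((1 ⊗ L) * rho b)).
    rewrite -Es mulr_suml [RHS]linear_sum; apply: eq_bigr => q _.
    by rewrite -mulrA -rmorphM [RHS]tens_ctr_mull.
  rewrite coact_sum mulr_sumr [LHS]linear_sum -[RHS]coact_counit_sum.
  by apply: eq_bigr => i _; rewrite otimesM mul1r [LHS]tens_ctrE fL.
- move=> b.
  have bil : bilin (fun (u : B) (h : H) => tens_ctr f (rho (b * u) * (1 ⊗ S h))).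
    split=> [u u' h|u h h'|u a h].
    + by rewrite mulrDr linearD mulrDl linearD.
    + by rewrite linearD otimesDr mulrDr linearD.
    + by rewrite -scalerAr !linearZ_LR /= -tens_scalerAl otimesZr tens_scalerAr.
  (* On (x ⊗ 1) rho(y) the antipode cancels the coaction of y and leaves E(b x) y; on 1 ⊗ L, S L = L
     and symmetry of f give b. *)
  pose Psi := tens_lift (fun (u : B) (h : H) => tens_ctr f (rho (b * u) * (1 ⊗ S h))).
  have PsiD : {morph Psi : u v / u + v} by exact: tens_liftD.
  have Psi0 : Psi 0 = 0 by exact: tens_lift0.
  have PsiE x y : Psi ((x ⊗ 1) * rho y) = coinv_val (E (b * x)) * y.
    rewrite [X in _ * X]coact_sum mulr_sumr (big_morph _ PsiD Psi0).
    transitivity (tens_ctr f (rho (b * x) * (y ⊗ 1))); last exact: tens_ctr_mulr.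
    rewrite -(coact_antipode y) [in RHS]mulr_sumr [RHS]linear_sum; apply: eq_bigr => i _.
    by rewrite otimesM mul1r /Psi (tens_lift_otimes bil) [in LHS](mulrA b) rmorphM -[in LHS]mulrA.
  have := congr1 Psi Es; rewrite (big_morph _ PsiD Psi0) => E1.
  apply: etrans (etrans _ E1) _.
    by apply: eq_bigr => q _; rewrite PsiE.
  rewrite /Psi (tens_lift_otimes bil) mulr1 SL coact_sum mulr_suml [LHS]linear_sum.
  rewrite -[RHS]coact_counit_sum.
  by apply: eq_bigr => i _; rewrite otimesM mulr1 [LHS]tens_ctrE fC fL.
- transitivity (tens_ctr eps ((1 : B) ⊗ L)); last by rewrite tens_ctrE /= epsL scale1r.
  rewrite -Es [RHS]linear_sum; apply: eq_bigr => q _; rewrite [RHS]tens_ctr_mull.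
  by rewrite -{1}(coact_counit q.2).
Qed.

(** T o E is T ⊗ f composed with the multiplicative rho, and T ⊗ f is symmetric because T and f
    are. *)
Lemma expectation_trace (R : lmodType k) (T : {linear B -> R}) :
  (forall x y, T (x * y) = T (y * x)) ->
  forall x y, T (coinv_val (E (x * y))) = T (coinv_val (E (y * x))).
Proof.
move=> TC x y; rewrite !expectationE !rmorphM /=.
move: (rho x) (rho y) => u v.
elim/tens_ind: u => [|a g u IHu]; first by rewrite mul0r mulr0.
rewrite mulrDl mulrDr !linearD IHu; congr (_ + _).
elim/tens_ind: v {u IHu} => [|b h v IHv]; first by rewrite mul0r mulr0.
rewrite mulrDl mulrDr !linearD IHv; congr (_ + _).
by rewrite !otimesM /= !tens_ctrE !linearZ /= TC fC.
Qed.

End Expectation.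
End Comodule.

(** * Discriminants *)

Section DetBlockDiagonal.
Variable R : comNzRingType.

Lemma det_castmx (n1 n2 : nat) (E E' : n1 = n2) (A : 'M[R]_n1) :
  \det (castmx (E, E') A) = \det A.
Proof. by case: n2 / E E' => E'; rewrite (eq_axiomK E') castmx_id. Qed.

Lemma det_mxdiag (m : nat) (p : 'I_m -> nat) (D : forall i, 'M[R]_(p i)) :
  \det (\mxdiag_i D i) = \prod_i \det (D i).
Proof.
elim: m => [|m IHm] in p D *.
  have det0 n (A : 'M[R]_n) : n = 0%N -> \det A = 1.
    by move=> n0; subst n; apply: det_mx00.
  by rewrite det0 ?big_ord0.
by rewrite mxdiag_recl det_castmx det_ublock IHm big_ord_recl.
Qed.

End DetBlockDiagonal.

Lemma sum_tagnat (V : nmodType) (m n : nat) (F : 'I_m -> 'I_n -> V) :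
  \sum_(l < \sum_(i < m) n) F (tagnat.sig1 l) (tagnat.sig2 l) = \sum_i \sum_p F i p.
Proof. by rewrite sig_big_dep (reindex _ tagnat.sig_bij_on). Qed.

Lemma det_congruence (R : comNzRingType) (p q : nat) (U V : 'M[R]_(q, p))
    (U' V' : 'M[R]_(p, q)) (Y : 'M[R]_p) (G : 'M[R]_q) :
  p = q -> U *m U' = 1%:M -> V *m V' = 1%:M -> G = U *m Y *m V^T ->
  eq_up_to_unit (\det Y) (\det G).
Proof.
move=> pq; subst p => UU' VV' ->.
have dU : \det U * \det U' = 1 by rewrite -det_mulmx UU' det1.
have dV : \det V * \det V' = 1 by rewrite -det_mulmx VV' det1.
exists (\det U' * \det V'), (\det U * \det V); split.
  by rewrite mulrACA [_ * \det U]mulrC [_ * \det V]mulrC dU dV mulr1.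
rewrite !det_mulmx det_tr mulrACA [\det V' * _]mulrC dV mulr1 mulrA.
by rewrite [\det U' * _]mulrC dU mul1r.
Qed.

(** * Coordinates, traces and Gram matrices in a basis *)

Section FreeBasis.
Variables (R : comNzRingType) (C : nzRingType) (iota : {rmorphism R -> C}).
Hypothesis iota_central : forall r c, iota r * c = c * iota r.

Lemma free_basisI n (z : 'I_n -> C) (c : C -> 'I_n -> R) :
  (forall x, x = \sum_i sub_act iota (c x i) (z i)) ->
  (forall d i, c (\sum_i sub_act iota (d i) (z i)) i = d i) ->
  free_basis (sub_act iota) z.
Proof.
move=> hc cK x; exists [ffun i => c x i]; split.
  by rewrite {1}(hc x); apply: eq_bigr => i _; rewrite ffunE.
by move=> d ->; apply/ffunP => i; rewrite ffunE cK.
Qed.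

Lemma coordsE n (z : 'I_n -> C) (c : C -> 'I_n -> R) :
  (forall x, x = \sum_i sub_act iota (c x i) (z i)) ->
  (forall d i, c (\sum_i sub_act iota (d i) (z i)) i = d i) ->
  forall x i, coords iota z x i = c x i.
Proof.
move=> hc cK x i; symmetry; apply: coords_unique (hc x) i.
exact: (free_basisI hc cK).
Qed.

Section Basis.
Variables (n : nat) (z : 'I_n -> C).
Hypothesis bz : free_basis (sub_act iota) z.
Notation co := (coords iota z).

Lemma coordsD x y i : co (x + y) i = co x i + co y i.
Proof.
symmetry; apply: (coords_unique bz (c := fun i => co x i + co y i)).
rewrite {1}(coordsP bz x) {1}(coordsP bz y) -big_split; apply: eq_bigr => l _.
by rewrite /sub_act rmorphD mulrDl.
Qed.

Lemma coordsZ r x i : co (iota r * x) i = r * co x i.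
Proof.
symmetry; apply: (coords_unique bz (c := fun i => r * co x i)).
rewrite {1}(coordsP bz x) mulr_sumr; apply: eq_bigr => l _.
by rewrite /sub_act rmorphM mulrA.
Qed.

Lemma coords0 i : co 0 i = 0.
Proof. by apply: (addrI (co 0 i)); rewrite -coordsD !addr0. Qed.

Lemma coords_sum I (s : seq I) (F : I -> C) i :
  co (\sum_(l <- s) F l) i = \sum_(l <- s) co (F l) i.
Proof.
by apply: (big_morph (fun x => co x i) _ (coords0 i)) => x y; apply: coordsD.
Qed.

Lemma lmul_mxM x y : lmul_mx iota z (x * y) = lmul_mx iota z x *m lmul_mx iota z y.
Proof.
apply/matrixP=> i j; rewrite !mxE -mulrA {1}(coordsP bz (y * z j)) mulr_sumr coords_sum.
apply: eq_bigr => l _; rewrite /sub_act mulrA -iota_central -mulrA coordsZ !mxE.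
by rewrite mulrC.
Qed.

Notation tr := (hs_trace iota z).

Lemma hs_traceC x y : tr (x * y) = tr (y * x).
Proof. by rewrite /hs_trace !lmul_mxM mxtrace_mulC. Qed.

Lemma hs_traceE x : tr x = \sum_i co (x * z i) i.
Proof. by apply: eq_bigr => i _; rewrite mxE. Qed.

Lemma hs_traceD x y : tr (x + y) = tr x + tr y.
Proof.
rewrite !hs_traceE -big_split; apply: eq_bigr => i _.
by rewrite mulrDl coordsD.
Qed.

Lemma hs_traceZ r x : tr (iota r * x) = r * tr x.
Proof.
rewrite !hs_traceE mulr_sumr; apply: eq_bigr => i _.
by rewrite -mulrA coordsZ.
Qed.

Lemma hs_trace0 : tr 0 = 0.
Proof. by apply: (addrI (tr 0)); rewrite -hs_traceD !addr0. Qed.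

Lemma hs_trace_sum I (s : seq I) (F : I -> C) :
  tr (\sum_(l <- s) F l) = \sum_(l <- s) tr (F l).
Proof. by apply: (big_morph tr hs_traceD hs_trace0). Qed.

Lemma change_basis_mulmx p (u : 'I_p -> C) : free_basis (sub_act iota) u ->
  (\matrix_(a, i) co (u a) i) *m (\matrix_(i, a) coords iota u (z i) a) = 1%:M.
Proof.
move=> bu; apply/matrixP=> a b; rewrite !mxE.
transitivity (coords iota u (u a) b); last first.
  symmetry; apply: (coords_unique bu (c := fun b => (a == b)%:R)).
  rewrite (bigD1 a) //= eqxx /sub_act rmorph1 mul1r big1 ?addr0 // => l.
  by rewrite eq_sym => /negbTE->; rewrite rmorph0 mul0r.
apply: (coords_unique bu (c := fun b => \sum_j _)).
rewrite {1}(coordsP bz (u a)).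
under [RHS]eq_bigr => l _ do rewrite /sub_act raddf_sum mulr_suml.
rewrite [RHS]exchange_big; apply: eq_bigr => j _ /=.
rewrite {1}(coordsP bu (z j)) /sub_act mulr_sumr; apply: eq_bigr => l _.
by rewrite !mxE rmorphM mulrA.
Qed.

(** Rows and columns may come from different families: below they are the left and the right tower
    basis. *)
Lemma gram_change_basis p (u v : 'I_p -> C) :
  \matrix_(a, b) tr (u a * v b) =
  (\matrix_(a, i) co (u a) i) *m (\matrix_(i, j) tr (z i * z j)) *m
  (\matrix_(a, i) co (v a) i)^T.
Proof.
apply/matrixP=> a b; rewrite !mxE {1}(coordsP bz (u a)) {1}(coordsP bz (v b)).
rewrite mulr_suml hs_trace_sum.
under [RHS]eq_bigr => j _ do rewrite !mxE mulr_suml.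
rewrite [RHS]exchange_big; apply: eq_bigr => i _ /=.
rewrite mulr_sumr hs_trace_sum; apply: eq_bigr => j _.
rewrite !mxE; set c := co (u a) i; set d := co (v b) j.
have -> : sub_act iota c (z i) * sub_act iota d (z j) = iota c * (iota d * (z i * z j)).
  by rewrite /sub_act -!mulrA; congr (_ * _); rewrite !mulrA iota_central.
by rewrite !hs_traceZ -mulrA; congr (_ * _); apply: mulrC.
Qed.

End Basis.
End FreeBasis.

(** * The discriminant of a Frobenius extension *)

Section FrobeniusDiscriminant.
Variables (R : comNzRingType) (A C : nzRingType).
Variables (iota : {rmorphism R -> A}) (j : {rmorphism A -> C}).
Notation iotaC := (j \o iota : {rmorphism R -> C}).
Hypothesis central : forall r c, j (iota r) * c = c * j (iota r).
Variables (n m : nat) (z : 'I_n -> A) (w w' : 'I_m -> C) (E : C -> A).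
Hypothesis bz : free_basis (sub_act iota) z.
Hypothesis ED : forall x y, E (x + y) = E x + E y.
Hypothesis Emull : forall a x, E (j a * x) = a * E x.
Hypothesis Emulr : forall a x, E (x * j a) = E x * a.
Hypothesis dual_right : forall x, x = \sum_i w i * j (E (w' i * x)).
Hypothesis dual_left : forall x, x = \sum_i j (E (x * w i)) * w' i.
Hypothesis dual_delta : forall i l, E (w' i * w l) = (i == l)%:R.

Notation trA := (hs_trace iota z).
Notation M := (\sum_(i < m) n)%N.
Notation s1 := tagnat.sig1.
Notation s2 := tagnat.sig2.

Let centralC r c : iotaC r * c = c * iotaC r := central r c.

Let E0 : E 0 = 0.
Proof. by apply: (addrI (E 0)); rewrite -ED !addr0. Qed.

Let Esum I (s : seq I) (F : I -> C) : E (\sum_(i <- s) F i) = \sum_(i <- s) E (F i).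
Proof. exact: (big_morph _ ED E0). Qed.

Definition right_tower_basis (l : 'I_M) : C := w (s1 l) * j (z (s2 l)).
Definition left_tower_basis (l : 'I_M) : C := j (z (s2 l)) * w' (s1 l).

Let right_coord (x : C) (l : 'I_M) : R := coords iota z (E (w' (s1 l) * x)) (s2 l).
Let left_coord (x : C) (l : 'I_M) : R := coords iota z (E (x * w (s1 l))) (s2 l).

Let right_coordP x : x = \sum_l sub_act iotaC (right_coord x l) (right_tower_basis l).
Proof.
pose F (i : 'I_m) (p : 'I_n) : C :=
  w i * j (sub_act iota (coords iota z (E (w' i * x)) p) (z p)).
transitivity (\sum_i \sum_p F i p).
  rewrite {1}(dual_right x); apply: eq_bigr => i _.
  by rewrite -mulr_sumr -rmorph_sum -(coordsP bz).
rewrite -sum_tagnat; apply: eq_bigr => l _.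
by rewrite /F /sub_act rmorphM mulrA -central -mulrA.
Qed.

Let left_coordP x : x = \sum_l sub_act iotaC (left_coord x l) (left_tower_basis l).
Proof.
pose F (i : 'I_m) (p : 'I_n) : C :=
  j (sub_act iota (coords iota z (E (x * w i)) p) (z p)) * w' i.
transitivity (\sum_i \sum_p F i p).
  rewrite {1}(dual_left x); apply: eq_bigr => i _.
  by rewrite -mulr_suml -rmorph_sum -(coordsP bz).
rewrite -sum_tagnat; apply: eq_bigr => l _.
by rewrite /F /sub_act rmorphM mulrA.
Qed.

Let coords_pair (d : 'I_M -> R) (l : 'I_M) :
  coords iota z (\sum_(l' < M) sub_act iota (d l') ((s1 l == s1 l')%:R * z (s2 l')))
    (s2 l) = d l.
Proof.
have -> : \sum_(l' < M) sub_act iota (d l') ((s1 l == s1 l')%:R * z (s2 l')) =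
    \sum_p sub_act iota (d (tagnat.Rank (s1 l) p)) (z p).
  pose F (i : 'I_m) (p : 'I_n) :=
    sub_act iota (d (tagnat.Rank i p)) ((s1 l == i)%:R * z p).
  transitivity (\sum_(l' < M) F (s1 l') (s2 l')).
    apply: eq_bigr => l' _; rewrite /F; congr (sub_act _ (d _) _).
    by rewrite /tagnat.Rank -[LHS]tagnat.sigK /tagnat.sig1 /tagnat.sig2; case: (tagnat.sig l').
  rewrite sum_tagnat (bigD1 (s1 l)) //= [X in _ + X]big1 ?addr0 => [|i /negbTE il]; last first.
    by rewrite big1 // => p _; rewrite /F eq_sym il mul0r /sub_act mulr0.
  by apply: eq_bigr => p _; rewrite /F eqxx mul1r.
rewrite -(coords_unique bz (c := fun p => d (tagnat.Rank (s1 l) p))) //.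
by congr d; rewrite /tagnat.Rank -[RHS]tagnat.sigK /tagnat.sig1 /tagnat.sig2; case: (tagnat.sig l).
Qed.

Let right_coordK d l :
  right_coord (\sum_l sub_act iotaC (d l) (right_tower_basis l)) l = d l.
Proof.
rewrite -[RHS]coords_pair /right_coord mulr_sumr Esum; congr (coords _ _ _ _).
apply: eq_bigr => l' _; rewrite /sub_act /= mulrA -central -mulrA Emull (mulrA (w' _)).
by rewrite Emulr dual_delta.
Qed.

Let left_coordK d l :
  left_coord (\sum_l sub_act iotaC (d l) (left_tower_basis l)) l = d l.
Proof.
rewrite -[RHS]coords_pair /left_coord mulr_suml Esum; congr (coords _ _ _ _).
apply: eq_bigr => l' _; rewrite /sub_act /= -!mulrA Emull Emull dual_delta.
by rewrite [s1 l == _]eq_sym mulr_natr mulr_natl.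
Qed.

Lemma right_tower_free : free_basis (sub_act iotaC) right_tower_basis.
Proof. exact: free_basisI right_coordP right_coordK. Qed.

Lemma left_tower_free : free_basis (sub_act iotaC) left_tower_basis.
Proof. exact: free_basisI left_coordP left_coordK. Qed.

Variables (N : nat) (y : 'I_N -> C).
Hypothesis basis_y : free_basis (sub_act iotaC) y.
Notation trC := (hs_trace iotaC y).

Lemma trace_right_tower b : trC b = \sum_i trA (E (w' i * b * w i)).
Proof.
rewrite (hs_trace_basis centralC basis_y right_tower_free) [LHS]hs_traceE.
pose F (i : 'I_m) (p : 'I_n) := coords iota z (E (w' i * b * w i) * z p) p.
transitivity (\sum_i \sum_p F i p).
  rewrite -sum_tagnat; apply: eq_bigr => l _.
  rewrite (coordsE right_coordP right_coordK) /right_coord /F.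
  by rewrite /right_tower_basis !mulrA Emulr.
by apply: eq_bigr => i _; rewrite hs_traceE.
Qed.

(** In the left tower basis, multiplication by j(a) acts on each of the m blocks as a acts on A. *)
Lemma trace_left_tower a : trC (j a) = trA a *+ m.
Proof.
rewrite (hs_trace_basis centralC basis_y left_tower_free) [LHS]hs_traceE.
pose F (i : 'I_m) (p : 'I_n) := coords iota z (a * z p) p.
transitivity (\sum_i \sum_p F i p).
  rewrite -sum_tagnat; apply: eq_bigr => l _.
  rewrite (coordsE left_coordP left_coordK) /left_coord /F.
  by rewrite /left_tower_basis -!mulrA Emull Emull dual_delta eqxx mulr1.
by rewrite hs_traceE -[X in _ *+ X](card_ord m) -sumr_const.
Qed.

Hypothesis dual_one : \sum_i w i * w' i = 1.
Hypothesis trace_E : forall x x', trC (j (E (x * x'))) = trC (j (E (x' * x))).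
Hypothesis m_reg : forall r r' : R, r *+ m = r' *+ m -> r = r'.

(** After multiplication by m, both sides become traces over C; cyclicity under E gathers the w_i
    w'_i, which sum to 1. *)
Lemma trace_expectation b : trC b = trA (E b).
Proof.
apply: m_reg; rewrite -trace_left_tower trace_right_tower -sumrMnl.
under eq_bigr => i _ do rewrite -trace_left_tower -mulrA trace_E -mulrA.
rewrite -(hs_trace_sum basis_y) -rmorph_sum -Esum -mulr_sumr.
by rewrite dual_one mulr1.
Qed.

Hypothesis natr_inj : injective (fun p : nat => p%:R : R).

Lemma discr_frobenius : eq_up_to_unit (discr iotaC y) (discr iota z ^+ m).
Proof.
pose U := \matrix_(a, i) coords iotaC y (left_tower_basis a) i.
pose V := \matrix_(a, i) coords iotaC y (right_tower_basis a) i.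
pose U' := \matrix_(i, a) coords iotaC left_tower_basis (y i) a.
pose V' := \matrix_(i, a) coords iotaC right_tower_basis (y i) a.
have UU' : U *m U' = 1%:M := change_basis_mulmx basis_y left_tower_free.
have U'U : U' *m U = 1%:M := change_basis_mulmx left_tower_free basis_y.
have VV' : V *m V' = 1%:M := change_basis_mulmx basis_y right_tower_free.
(* Both ranks are traces of identity matrices, [U' *m U] and [U *m U'], so they agree in R, where
   distinct naturals stay distinct. *)
have EN : N = M.
  apply: natr_inj; rewrite -(mxtrace1 R N) -(mxtrace1 R M) -UU' -U'U.
  exact: mxtrace_mulC.
have gram := gram_change_basis centralC basis_y left_tower_basis right_tower_basis.
have gramE : \matrix_(a, b) trC (left_tower_basis a * right_tower_basis b) =
    \mxdiag_(i < m) (\matrix_(p, q) trA (z p * z q)).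
  apply/matrixP=> a b; rewrite !mxE trace_expectation.
  rewrite /left_tower_basis /right_tower_basis -!mulrA Emull !mulrA.
  rewrite Emulr dual_delta.
  case: ifP => h; rewrite ?h ?conform_mx_id mxE ?mul1r // mul0r mulr0.
  exact: hs_trace0 bz.
rewrite gramE in gram.
have detD : \det (\mxdiag_(i < m) (\matrix_(p, q) trA (z p * z q))) = discr iota z ^+ m.
  by rewrite det_mxdiag prodr_const card_ord.
rewrite -detD; exact: det_congruence EN UU' VV' gram.
Qed.

End FrobeniusDiscriminant.

Theorem lemma5p6 (k : fieldType) (H : hopfAlgebra k) (B : comodAlgebra H)
    (R : comAlgType k) (iota : {lrmorphism R -> coinv B})
    (n m N : nat) (z : 'I_n -> coinv B) (w : 'I_m -> B) (y : 'I_N -> B) :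
  [pchar k] =i pred0 ->
  semisimple H ->
  Hopf_Galois B ->
  injective iota ->
  (forall (r : R) (b : B), coinv_val (iota r) * b = b * coinv_val (iota r)) ->
  free_basis (sub_act iota) z ->
  free_basis (fun (a : coinv B) (b : B) => b * coinv_val a) w ->
  free_basis (sub_act (fun r : R => coinv_val (iota r))) y ->
  eq_up_to_unit (discr (fun r : R => coinv_val (iota r)) y) (discr iota z ^+ m).
Proof.
move=> ch0 ss gal _ central bz bw fy.
have [f [L [fC f_int fL [SL eL]]]] := semisimple_integrals ch0 ss.
pose E : B -> coinv B := expectation f_int.
have Emull a x : E (coinv_val a * x) = a * E x by apply: expectation_mull.
have Emulr a x : E (x * coinv_val a) = E x * a by apply: expectation_mulr.
have Esum I (s : seq I) (F : I -> B) :
    E (\sum_(i <- s) F i) = \sum_(i <- s) E (F i) by apply: expectation_sum.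
have [s [dual1 dual2 dual3]] := galois_dual_basis fC f_int fL SL eL gal.
have /choice[c hc] : forall x : B, exists c : {ffun 'I_m -> coinv B},
    x = \sum_i w i * coinv_val (c i) /\
    forall d : {ffun 'I_m -> coinv B}, x = \sum_i w i * coinv_val (d i) -> c = d.
  by move=> x; have [c [h u]] := bw x; exists c; split=> // d /u.
have cE x : x = \sum_i w i * coinv_val (c x i) := (hc x).1.
have c_unique x (d : 'I_m -> coinv B) : x = \sum_i w i * coinv_val (d i) -> forall i, c x i = d i.
  move=> h i; rewrite ((hc x).2 [ffun i => d i]) ?ffunE // {1}h.
  by apply: eq_bigr => l _; rewrite ffunE.
(* Expanding the first legs of the dual pairs in the right basis [w] and collecting coefficients
   gives its dual left basis. *)
pose w' i : B := \sum_(q <- s) coinv_val (c q.1 i) * q.2.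
have Ew' i x : E (w' i * x) = c x i.
  rewrite /w' mulr_suml Esum; under eq_bigr => q _ do rewrite -mulrA Emull.
  symmetry; apply: (c_unique x (fun i => \sum_(q <- s) c q.1 i * E (q.2 * x))).
  rewrite -{1}(dual1 x).
  under [RHS]eq_bigr => l _ do rewrite raddf_sum mulr_sumr.
  rewrite exchange_big; apply: eq_bigr => q _ /=.
  rewrite {1}(cE q.1) mulr_suml; apply: eq_bigr => l _.
  by rewrite -mulrA.
(* Any additive right A-linear F transfers identities from the pairs in [s] to (w, w'); it is used
   for F = E(x _) and for the identity. *)
have w'sum (F : B -> B) : (forall I (t : seq I) G, F (\sum_(i <- t) G i) = \sum_(i <- t) F (G i)) ->
    (forall x a, F (x * coinv_val a) = F x * coinv_val a) ->
    \sum_i F (w i) * w' i = \sum_(q <- s) F q.1 * q.2.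
  move=> Fsum Fmul; under eq_bigr => i _ do rewrite /w' mulr_sumr.
  rewrite exchange_big; apply: eq_bigr => q _ /=.
  rewrite {2}(cE q.1) Fsum mulr_suml; apply: eq_bigr => i _.
  by rewrite Fmul mulrA.
pose jB : {rmorphism coinv B -> B} := @coinv_val k H B.
pose iotaB : {rmorphism R -> B} := jB \o iota.
have centralB r b : iotaB r * b = b * iotaB r by apply: central.
have fyB : free_basis (sub_act iotaB) y by [].
pose tr : B -> R := hs_trace iotaB y.
have tr_linear : linear tr.
  move=> a b b'; rewrite /tr (hs_traceD fyB); congr (_ + _).
  have -> : a *: b = iotaB a%:A * b.
    by rewrite /iotaB /= !linearZ /= !rmorph1 -scalerAl mul1r.
  by rewrite (hs_traceZ fyB) -scalerAl mul1r.
(* An empty right basis would force 1 = 0 in B. *)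
have m0 : m%:R != 0 :> k.
  rewrite ((pcharf0P k).1 ch0); apply: contraNneq (oner_neq0 B) => m0.
  by subst m; rewrite (cE 1) big_ord0.
apply: (@discr_frobenius R (coinv B) B iota jB centralB n m z w w' E) => //.
- by move=> x x'; have := Esum _ [:: x; x'] id; rewrite !big_cons !big_nil !addr0.
- by move=> x; under eq_bigr => i _ do rewrite Ew'.
- move=> x; rewrite (w'sum (fun b => coinv_val (E (x * b)))) //.
    by move=> I t G; rewrite mulr_sumr Esum raddf_sum.
  by move=> b a; rewrite mulrA Emulr.
- move=> i l; rewrite Ew'; apply: (c_unique _ (fun i => (i == l)%:R)).
  rewrite (bigD1 l) //= eqxx rmorph1 mulr1 big1 ?addr0 // => i' /negbTE->.
  by rewrite rmorph0 mulr0.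
- by rewrite (w'sum id).
- move=> x x'; apply: (expectation_trace fC f_int (T := mk_linear tr_linear)).
  exact: hs_traceC.
- move=> r r' rm; apply: (scalerI m0); rewrite !scaler_nat; exact: rm.
- move=> p q E1; apply: (natr_inj_pchar0 ch0); apply/eqP; rewrite -subr_eq0.
  have : (p%:R - q%:R : k) *: (1 : R) == 0 by rewrite scalerBl !scaler_nat subr_eq0 E1.
  by rewrite scaler_eq0 oner_eq0 orbF.
Qed.
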